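(* Let $\phi$ be a hyperbolic automorphism of the unit disk $\mathbb{D}$ and $\eta$ its attractive fixed point. Let $\nu\in\mathbb{R}$ and $\lambda\in\mathbb{C}$. Then $\lambda C_\phi$ is recurrent on $\mathcal{S}_\nu$ if and only if $\nu<1/2$ and $$\phi'(\eta)^{(1-2\nu)/2}<|\lambda|<\phi'(\eta)^{(2\nu-1)/2}.$$
   Context: $\mathbb{D}$ is the open unit disk of $\mathbb{C}$. For $\nu\in\mathbb{R}$, the weighted Dirichlet space $\mathcal{S}_\nu$ is the Hilbert space of analytic functions $f(z)=\sum_{n\ge 0}a_nz^n$ on $\mathbb{D}$ with $\|f\|_\nu^2=\sum_{n\ge0}|a_n|^2(n+1)^{2\nu}<\infty$. For a self-map $\phi$ of $\mathbb{D}$, $C_\phi f=f\circ\phi$; it is known that $C_\phi$ is bounded on every $\mathcal{S}_\nu$ when $\phi$ is a linear fractional self-map of $\mathbb{D}$. A bounded linear operator $T$ on a Hilbert space $\mathcal{H}$ is recurrent if for every non-empty open $U\subset\mathcal{H}$ there is a positive integer $n$ with $T^n(U)\cap U\neq\emptyset$. A linear fractional map ($\phi(z)=\frac{az+b}{cz+d}$, $ad-bc\ne0$) other than the identity with two distinct fixed points in $\hat{\mathbb{C}}=\mathbb{C}\cup\{\infty\}$ is conjugate (by a linear fractional map) to a dilation $z\mapsto\mu z$; it is hyperbolic if $\mu>0$ (with $\mu\neq1$). A hyperbolic automorphism of $\mathbb{D}$ has both fixed points on the unit circle; the attractive fixed point $\eta$ is the one at which the derivative is less than $1$, and $0<\phi'(\eta)<1$.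 *)

(* Defs.v *)
From HB Require Import structures.
From mathcomp Require Import all_boot all_order all_algebra complex.
From mathcomp Require Import all_classical all_reals all_analysis.

Set Implicit Arguments.
Unset Strict Implicit.
Unset Printing Implicit Defensive.

Import Order.TTheory GRing.Theory Num.Theory numFieldNormedType.Exports.

Local Open Scope classical_set_scope.
Local Open Scope ring_scope.
Local Open Scope complex_scope.

(* The library equips every abstract numFieldType with the topology and the
   normed-module structure given by its norm, but does not attach them to the
   concrete type R[i]. *)
HB.instance Definition _ (R : realType) :=
  NormedModule.copy R[i] (R[i] : numFieldType)^o.

Section LinearFractional.
Variable R : realType.
Local Notation C := R[i].

Record lft := Lft {
  lft_a : C; lft_b : C; lft_c : C; lft_d : C;
  lft_det : lft_a * lft_d - lft_b * lft_c != 0 }.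

(* The value at a pole is the junk value 0. *)
Definition lft_fun (phi : lft) (z : C) : C :=
  (lft_a phi * z + lft_b phi) / (lft_c phi * z + lft_d phi).

(* Action on the Riemann sphere [option C], where [None] is infinity. *)
Definition lft_sphere (phi : lft) (z : option C) : option C :=
  match z with
  | Some w => if lft_c phi * w + lft_d phi == 0 then None
              else Some (lft_fun phi w)
  | None => if lft_c phi == 0 then None else Some (lft_a phi / lft_c phi)
  end.

Definition hyperbolic (phi : lft) : Prop :=
  [/\ exists z, lft_sphere phi z <> z,
      exists p q, [/\ p <> q, lft_sphere phi p = p & lft_sphere phi q = q] &
      exists (sigma : lft) (mu : R), [/\ 0 < mu, mu != 1 &
        forall z, lft_sphere sigma (lft_sphere phi z) =
                  omap (fun w => mu%:C * w) (lft_sphere sigma z)]].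

Definition unit_disk : set C := [set z | `|z| < 1].

Definition disk_automorphism (phi : lft) : Prop :=
  set_bij (Some @` unit_disk) (Some @` unit_disk) (lft_sphere phi).

(* In the order of R[i], [x < 1] means that x is real and less than 1. *)
Definition attractive_fixpoint (phi : lft) (eta : C) : Prop :=
  [/\ `|eta| = 1, lft_sphere phi (Some eta) = Some eta &
      derive1 (lft_fun phi) eta < 1].

End LinearFractional.

(* Elements of the Dirichlet spaces are represented by functions R[i] -> R[i]
   of which only the restriction to the unit disk matters: functions that agree
   on the disk are at distance 0, hence belong to the same open sets. *)
Section Dirichlet.
Variable R : realType.
Local Notation C := R[i].

Definition has_taylor (f : C -> C) (a : nat -> C) : Prop :=
  forall z, unit_disk z -> series (fun n => a n * z ^+ n) @ \oo --> f z.

Definition taylor (f : C -> C) : nat -> C := get (has_taylor f).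

Definition sqnorm (nu : R) (a : nat -> C) : \bar R :=
  (\sum_(0 <= n <oo) (Normc.normc (a n) ^+ 2 * n.+1%:R `^ (2 * nu))%:E)%E.

Definition dirichlet (nu : R) : set (C -> C) :=
  [set f | exists2 a, has_taylor f a & (sqnorm nu a < +oo)%E].

Definition dirichlet_norm (nu : R) (f : C -> C) : R :=
  Num.sqrt (fine (sqnorm nu (taylor f))).

Definition dirichlet_open (nu : R) (U : set (C -> C)) : Prop :=
  U `<=` dirichlet nu /\
  forall f, U f -> exists2 e : R, 0 < e &
    forall g, dirichlet nu g ->
      dirichlet_norm nu (fun z => g z - f z) < e -> U g.

(* Recurrence on S_nu of an operator given on all functions; it is meant for
   operators that restrict to bounded operators on S_nu. *)
Definition recurrent (nu : R) (T : (C -> C) -> (C -> C)) : Prop :=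
  forall U, dirichlet_open nu U -> U !=set0 ->
    exists2 n : nat, (0 < n)%N & (iter n T @` U) `&` U !=set0.

Definition scaled_composition (lambda : C) (phi : lft R) (f : C -> C) : C -> C :=
  fun z => lambda * f (lft_fun phi z).

End Dirichlet.

(* Main.v *)
(* Write [flow k] for the Moebius map [u] defined by
   [(u - eta) / (u - eta') = k (z - eta) / (z - eta')], where [eta'] is the other
   fixed point; it lies on the unit circle because the disk is invariant in both
   directions. Then [phi = flow mu] on the disk with [mu = phi'(eta)], so
   [phi^n = flow (mu^n)], and [phi^-1] is obtained by exchanging the fixed points.

   Necessity. If [|lambda|] is at most [mu^((1 - 2 nu) / 2)] (or at most [1] when
   [nu >= 1/2]), the functionals
   [f |-> lambda^n (f (phi^n t) - f (phi^n 0))] are uniformly bounded: [f] is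
   Lipschitz on [|z| <= r] with constant [O((1 - r)^(-(3 - 2 nu) / 2))], while
   [phi^n t - phi^n 0 = O(mu^n)] and [1 - |phi^n| >= c mu^n]. For [f = id] and
   small [t] their values at [n >= 1] are bounded by [kappa < t], whereas the
   value at [n = 0] is [t], so no [n >= 1] can bring a small neighbourhood of
   [id] back to itself. For large [|lambda|] the same applies to the inverse.

   Sufficiency. [phi^n - eta = alpha (z - eta) / (1 - rho z)] with
   [alpha = O(mu^n)] and [|rho| <= 1 - c mu^n], so the coefficients of its [j]-th
   power are [O(mu^(n j) i^(j - 1) (1 - c mu^n)^i)] and its squared norm is
   [O(mu^(n (1 - 2 nu)))] for large [j]. Hence [lambda^n x(phi^n) -> 0] for the
   polynomials [x] divisible by a high power of [z - eta], and likewise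
   [lambda^-n y(phi^-n) -> 0] for those divisible by a power of [z - eta']. Both
   classes are dense, and [x + lambda^-n y(phi^-n)] is a point close to [x]
   which the [n]-th iterate sends close to [y]. *)

Require Import Defs.
From mathcomp Require Import all_boot all_order all_algebra complex.
From mathcomp Require Import all_classical all_reals all_analysis.
From mathcomp Require Import ring lra.
Import Order.TTheory GRing.Theory Num.Theory numFieldNormedType.Exports.
Local Open Scope classical_set_scope.
Local Open Scope ring_scope.
Local Open Scope complex_scope.

Set Implicit Arguments.
Unset Strict Implicit.
Unset Printing Implicit Defensive.

Import Normc.

(** * The modulus with real values *)

Section NormC.
Variable R : realType.
Local Notation C := R[i].
Implicit Types (z w : C) (e x : R).

Lemma normr_normc z : `|z| = (normc z)%:C.
Proof. by []. Qed.

Lemma normc_ge0 z : 0 <= normc z.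
Proof. by rewrite -lecR; exact: normr_ge0 z. Qed.

Lemma normc_gt0 z : (0 < normc z) = (z != 0).
Proof. by rewrite -ltcR -normr_normc normr_gt0. Qed.

Lemma sqr_normcE z : normc z ^+ 2 = complex.Re z ^+ 2 + complex.Im z ^+ 2.
Proof. by case: z => a b /=; rewrite sqr_sqrtr // addr_ge0 // sqr_ge0. Qed.

Lemma normcX z n : normc (z ^+ n) = normc z ^+ n.
Proof.
elim: n => [|n IHn]; first by rewrite !expr0 normc1.
by rewrite !exprS normcM IHn.
Qed.

Lemma normcR x : normc x%:C = `|x|.
Proof. by rewrite /= expr0n /= addr0 sqrtr_sqr. Qed.

Lemma normcBC z w : normc (z - w) = normc (w - z).
Proof. by rewrite -normcN opprB. Qed.

Lemma ler_normcD z w : normc (z + w) <= normc z + normc w.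
Proof. exact: le_normcD. Qed.

Lemma ler_normcB z w : normc (z - w) <= normc z + normc w.
Proof. by rewrite -(normcN w) ler_normcD. Qed.

Lemma lerB_normcB z w : normc z - normc w <= normc (z - w).
Proof. by rewrite lerBlDr -{1}(subrK w z) ler_normcD. Qed.

Lemma ler_normc_sum I (r : seq I) (F : I -> C) :
  normc (\sum_(i <- r) F i) <= \sum_(i <- r) normc (F i).
Proof.
elim/big_ind2: _ => [|x a y b ha hb|//]; first by rewrite normc0.
by apply: le_trans (ler_normcD _ _) _; exact: lerD.
Qed.

Lemma unit_diskE z : unit_disk z = (normc z < 1) :> Prop.
Proof. by rewrite /unit_disk /= normr_normc -[1 in LHS]/(1%:C) ltcR. Qed.

Lemma cvgcP (u : nat -> C) (l : C) :
  u @ \oo --> l <->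
  forall e, 0 < e -> exists N, forall n, (N <= n)%N -> normc (u n - l) < e.
Proof.
split=> [/cvgrPdist_lt ul e e0|ul].
  have /ul [N _ hN] : (0 : C) < e%:C by rewrite ltcR.
  exists N => n Nn; rewrite normcBC.
  by have := hN n Nn; rewrite /= normr_normc ltcR.
(* In the order of [R[i]] a positive tolerance has zero imaginary part. *)
apply/cvgrPdist_lt => -[e e'] e0; have /andP[/eqP /= e'0 /= {}e0] := e0.
have [N hN] := ul e e0; exists N => // n /= Nn.
by rewrite e'0 normr_normc ltcR normcBC hN.
Qed.

End NormC.

Lemma eq_ler {R : numDomainType} (x y : R) : x = y -> x <= y.
Proof. by move->. Qed.

Lemma ler_sum_geom {R : realType} (x : R) n : 0 <= x < 1 ->
  \sum_(j < n) x ^+ j <= (1 - x)^-1.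
Proof.
move=> /andP[x0 x1]; rewrite -[_^-1]mul1r ler_pdivlMr ?subr_gt0 // mulrC.
by rewrite -opprB mulNr -subrX1 opprB gerBl exprn_ge0.
Qed.

(** * Taylor coefficients, their uniqueness, and Dirichlet norms *)

Section Taylor.
Variable R : realType.
Local Notation C := R[i].
Implicit Types (f g : C -> C) (a b : nat -> C) (nu A B : R).

Lemma has_taylor_eq f g a :
  (forall z, normc z < 1 -> f z = g z) -> has_taylor f a -> has_taylor g a.
Proof. by move=> fg fa z hz; rewrite -fg -?unit_diskE //; exact: fa. Qed.

Lemma has_taylorD f g a b : has_taylor f a -> has_taylor g b ->
  has_taylor (fun z => f z + g z) (fun n => a n + b n).
Proof.
move=> fa gb z hz.
under [X in series X]eq_fun do rewrite mulrDl.
rewrite (seriesD (fun n => a n * z ^+ n) (fun n => b n * z ^+ n)).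
exact: cvgD (fa z hz) (gb z hz).
Qed.

Lemma has_taylorZ (c : C) f a : has_taylor f a ->
  has_taylor (fun z => c * f z) (fun n => c * a n).
Proof.
move=> fa z hz.
under [X in series X]eq_fun do rewrite -mulrA.
have -> : series (fun n => c * (a n * z ^+ n)) =
    (fun n => c * series (fun n => a n * z ^+ n) n).
  by apply/funext => n; rewrite /series /= mulr_sumr.
exact: cvgMl_tmp (fa z hz).
Qed.

Lemma has_taylorB f g a b : has_taylor f a -> has_taylor g b ->
  has_taylor (fun z => f z - g z) (fun n => a n - b n).
Proof.
move=> fa gb; have := has_taylorD fa (has_taylorZ (c := -1) gb).
under [X in has_taylor X _]eq_fun do rewrite mulN1r.
by under [X in has_taylor _ X]eq_fun do rewrite mulN1r.
Qed.

Lemma has_taylor_poly (p : {poly C}) :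
  has_taylor (fun z => p.[z]) (fun n => p`_n).
Proof.
move=> z _; apply/cvgcP => e e0; exists (size p) => n pn.
rewrite horner_coef /series /= (big_cat_nat (leq0n _) pn) //= big_mkord.
rewrite addrAC subrr add0r.
rewrite big_nat_cond big1 ?normc0 // => i /andP[/andP[pi _] _].
by rewrite nth_default // mul0r.
Qed.

(** A term is the difference of two consecutive partial sums, both within 1 of the limit from some
    index on; the finitely many earlier terms are bounded by the sum of their moduli. *)
Lemma cvg_series_bounded_terms (a : nat -> C) z (l : C) :
  series (fun n => a n * z ^+ n) @ \oo --> l ->
  exists2 K : R, 0 < K & forall n, normc (a n) * normc z ^+ n <= K.
Proof.
move=> /cvgcP /(_ _ ltr01)[N hN].
have K0 : 0 <= \sum_(j < N) normc (a j) * normc z ^+ j.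
  by apply: sumr_ge0 => i _; rewrite mulr_ge0 ?exprn_ge0 ?normc_ge0.
exists (2 + \sum_(j < N) normc (a j) * normc z ^+ j) => [|n].
  by rewrite ltr_wpDr.
have [Nn|nN] := leqP N n.
  rewrite -normcX -normcM.
  have := hN n Nn; have := hN n.+1 (leqW Nn); rewrite seriesSr.
  set s := series _ n; set t := (X in s + X) => h1 h2.
  have -> : a n * z ^+ n = (s + t - l) - (s - l) by rewrite /t; ring.
  by apply: le_trans (ler_normcB _ _) _; lra.
rewrite (bigD1 (Ordinal nN)) //= addrCA lerDl addr_ge0 // sumr_ge0 // => i _.
by rewrite mulr_ge0 ?exprn_ge0 ?normc_ge0.
Qed.

(** At a small [t > 0] the series is [a 0] plus a tail. The terms at [1/2] are bounded by some [K],
    so the tail is at most [4 K t] and [a 0] is arbitrarily small. *)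
Lemma power_series_coef0 a :
  (forall z, 0 < normc z < 1 -> series (fun n => a n * z ^+ n) @ \oo --> 0) ->
  a 0%N = 0.
Proof.
move=> ha; have h2 : normc (2^-1 : R)%:C = 2^-1 by rewrite normcR ger0_norm.
have [K K0 hK] := cvg_series_bounded_terms (ha (2^-1 : R)%:C ltac:(rewrite h2; lra)).
apply: eq0_normc; apply/eqP; rewrite eq_le normc_ge0 andbT.
apply/ler_addgt0Pr => e e0; rewrite add0r.
pose t : R := Num.min (4^-1) (e / (8 * K)).
have t0 : 0 < t by rewrite lt_min invr_gt0 ltr0n divr_gt0 ?mulr_gt0.
have t4 : t <= 4^-1 by rewrite ge_min lexx.
have te : 4 * K * t <= e / 2.
  have : t <= e / (8 * K) by rewrite ge_min lexx orbT.
  by rewrite ler_pdivlMr ?mulr_gt0 //; lra.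
have nt : normc t%:C = t by rewrite normcR gtr0_norm.
have /cvgcP/(_ (e / 2))[|N hN] := ha t%:C ltac:(rewrite nt; lra).
  by rewrite divr_gt0.
have := hN N.+1 (leqnSn _); rewrite /series /= big_mkord big_ord_recl /= mulr1.
rewrite subr0 => h.
suff h3 : normc (\sum_(i < N) a (bump 0 i) * t%:C ^+ (bump 0 i)) <= 4 * K * t.
  have := lerB_normcB (a 0%N) (- \sum_(i < N) a (bump 0 i) * t%:C ^+ (bump 0 i)).
  by rewrite opprK normcN; lra.
apply: le_trans (ler_normc_sum _ _) _.
apply: (@le_trans _ _ (\sum_(i < N) (2 * t) ^+ i * (K * (2 * t)))).
  apply: ler_sum => i _; rewrite normcM normcX nt /bump /= add1n.
  have -> : normc (a i.+1) * t ^+ i.+1 =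
      (2 * t) ^+ i.+1 * (normc (a i.+1) * 2^-1 ^+ i.+1).
    by rewrite mulrCA -exprMn mulrAC divff ?pnatr_eq0 // mul1r.
  rewrite exprSr -mulrA ler_wpM2l ?exprn_ge0 ?mulr_ge0 ?(ltW t0) //.
  by rewrite [leRHS]mulrC ler_wpM2l ?mulr_ge0 ?(ltW t0) // -h2.
rewrite -mulr_suml -[leRHS](_ : 2 * (K * (2 * t)) = _); last by ring.
rewrite ler_wpM2r ?mulr_ge0 ?(ltW K0) ?(ltW t0) //.
apply: le_trans (ler_sum_geom _ _) _; first by lra.
by rewrite -[leRHS]invrK lef_pV2 ?posrE ?invr_gt0 //; lra.
Qed.

(** Once [a 0 = 0], dividing by [z] shifts the sequence, which gives an induction; this division is
    why the hypothesis avoids [z = 0]. *)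
Lemma power_series_eq0 a :
  (forall z, 0 < normc z < 1 -> series (fun n => a n * z ^+ n) @ \oo --> 0) ->
  forall n, a n = 0.
Proof.
move=> ha n; elim: n a ha => [|n IHn] a ha; first exact: power_series_coef0.
apply: (IHn (fun n => a n.+1)) => z hz; have a0 := power_series_coef0 ha.
have z0 : 0 < normc z by case/andP: hz.
apply/cvgcP => e e0.
have /cvgcP/(_ (e * normc z))[|N hN] := ha z hz; first by rewrite mulr_gt0.
exists N => m Nm; have := hN m.+1 (leqW Nm).
rewrite /series /= !big_mkord big_ord_recl a0 mul0r add0r !subr0.
rewrite (eq_bigr (fun i : 'I_m => a i.+1 * z ^+ i * z)) => [|i _]; last first.
  by rewrite exprSr mulrA.
by rewrite -mulr_suml normcM ltr_pM2r.
Qed.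

Lemma has_taylor_uniq f a b : has_taylor f a -> has_taylor f b -> a = b.
Proof.
move=> fa fb; apply/funext => n; apply/eqP; rewrite -subr_eq0; apply/eqP.
apply: (@power_series_eq0 (fun n => a n - b n)) => z /andP[_ hz].
have := has_taylorB fa fb (z := z); rewrite subrr; apply.
by rewrite unit_diskE.
Qed.

Lemma taylorE f a : has_taylor f a -> taylor f = a.
Proof.
move=> fa; apply: has_taylor_uniq (fa).
by rewrite /taylor; case: xgetP => [b -> //|/(_ a)].
Qed.

(** Bounding all partial sums keeps the norm estimates inside [R], away from limits in [\bar R]. *)
Definition sqnorm_le nu a B := forall N : nat,
  \sum_(n < N) normc (a n) ^+ 2 * n.+1%:R `^ (2 * nu) <= B.

Lemma sqnorm_leP nu a B : sqnorm_le nu a B <-> (sqnorm nu a <= B%:E)%E.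
Proof.
have ge0 n : (0 <= (normc (a n) ^+ 2 * n.+1%:R `^ (2 * nu))%:E)%E.
  by rewrite lee_fin mulr_ge0 ?sqr_ge0 ?powR_ge0.
split=> [aB|aB N].
  apply: lime_le; first exact: is_cvg_nneseries.
  by apply: nearW => N; rewrite /= sumEFin lee_fin big_mkord; exact: aB.
rewrite -lee_fin; apply: le_trans aB; rewrite -sumEFin.
have := @nneseries_lim_ge _ _ xpredT 0 N (fun n _ _ => ge0 n).
by rewrite big_mkord.
Qed.

Lemma sqnorm_le_ge0 nu a B : sqnorm_le nu a B -> 0 <= B.
Proof. by move=> /(_ 0%N); rewrite big_ord0. Qed.

Lemma sqnorm_leW nu a A B : A <= B -> sqnorm_le nu a A -> sqnorm_le nu a B.
Proof. by move=> AB aA N; exact: le_trans (aA N) AB. Qed.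

Lemma eq_sqnorm_le nu a b B : (forall n, a n = b n) ->
  sqnorm_le nu a B -> sqnorm_le nu b B.
Proof. by move=> /funext ->. Qed.

(** The inequality [(x + y)^2 <= 2 x^2 + 2 y^2] stands in for the triangle inequality and avoids
    square roots. *)
Lemma sqnorm_leD nu a b A B : sqnorm_le nu a A -> sqnorm_le nu b B ->
  sqnorm_le nu (fun n => a n + b n) (2 * A + 2 * B).
Proof.
move=> aA bB N; apply: le_trans (lerD (ler_wpM2l _ (aA N)) (ler_wpM2l _ (bB N))) => //.
rewrite !mulr_sumr -big_split /=; apply: ler_sum => i _.
rewrite !mulrA -mulrDl ler_wpM2r ?powR_ge0 //.
rewrite (le_trans (_ : _ <= (normc (a i) + normc (b i)) ^+ 2)) //.
  by rewrite ler_pXn2r ?nnegrE ?addr_ge0 ?normc_ge0 ?ler_normcD.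
by have := sqr_ge0 (normc (a i) - normc (b i)); nra.
Qed.

Lemma sqnorm_leZ nu (c : C) a A : sqnorm_le nu a A ->
  sqnorm_le nu (fun n => c * a n) (normc c ^+ 2 * A).
Proof.
move=> aA N; apply: le_trans (ler_wpM2l (sqr_ge0 _) (aA N)).
rewrite mulr_sumr; apply: ler_sum => i _.
by rewrite normcM exprMn -mulrA.
Qed.

Lemma sqnorm_leB nu a b A B : sqnorm_le nu a A -> sqnorm_le nu b B ->
  sqnorm_le nu (fun n => a n - b n) (2 * A + 2 * B).
Proof.
move=> aA /(sqnorm_leZ (-1)); rewrite normcN normc1 expr1n mul1r => bB.
by have := sqnorm_leD aA bB; under eq_fun do rewrite mulN1r.
Qed.

Lemma sqnorm_ge0 nu a : (0 <= sqnorm nu a)%E.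
Proof.
apply: nneseries_ge0 => n _ _.
by rewrite lee_fin mulr_ge0 ?sqr_ge0 ?powR_ge0.
Qed.

Lemma dirichletP nu f :
  dirichlet nu f <-> exists a B, has_taylor f a /\ sqnorm_le nu a B.
Proof.
split=> [[a fa hlt]|[a [B [fa /sqnorm_leP aB]]]]; last first.
  by exists a => //; apply: le_lt_trans aB (ltry _).
exists a, (fine (sqnorm nu a)); split=> //; apply/sqnorm_leP.
by rewrite fineK // ge0_fin_numE // sqnorm_ge0.
Qed.

Lemma dirichlet_norm_le nu f a B : has_taylor f a -> sqnorm_le nu a B ->
  dirichlet_norm nu f <= Num.sqrt B.
Proof.
move=> fa aB; rewrite /dirichlet_norm (taylorE fa); apply: ler_wsqrtr.
move/sqnorm_leP: aB => aB; rewrite -lee_fin fineK // ge0_fin_numE ?sqnorm_ge0//.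
exact: le_lt_trans aB (ltry _).
Qed.

Lemma sqnorm_le_dirichlet_norm nu f a : has_taylor f a -> dirichlet nu f ->
  sqnorm_le nu a (dirichlet_norm nu f ^+ 2).
Proof.
move=> fa [b fb hlt]; rewrite (has_taylor_uniq fa fb).
apply/sqnorm_leP; rewrite /dirichlet_norm (taylorE fb) sqr_sqrtr.
  by rewrite fineK // ge0_fin_numE ?sqnorm_ge0.
by rewrite fine_ge0 // sqnorm_ge0.
Qed.

End Taylor.

(** * Power-weighted geometric sums and Cauchy-Schwarz *)

Section Sums.
Variable R : realType.
Implicit Types (s x y d X Y : R).

(* [t^s <= (s/d)^s exp (d t)], since [u <= exp u] for [u = d t / s]. *)
Lemma powR_geom_le s : 0 < s -> exists2 C : R, 0 < C &
  forall x (j : nat), 0 <= x < 1 -> j.+1%:R `^ s * x ^+ j <= C * (1 - x) `^ (- s).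
Proof.
move=> s0; exists (s `^ s * expR 1) => [|x j /andP[x0 x1]].
  by rewrite mulr_gt0 ?powR_gt0 ?expR_gt0.
set d := 1 - x; have d0 : 0 < d by rewrite subr_gt0.
rewrite powRN ler_pdivlMr ?powR_gt0 // mulrAC -powRM ?(ltW d0) //.
have h1 : (j.+1%:R * d) `^ s <= s `^ s * expR (j.+1%:R * d).
  have u0 : 0 <= j.+1%:R * d by rewrite mulr_ge0 // ltW.
  have h : j.+1%:R * d <= s * expR (j.+1%:R * d / s).
    rewrite -ler_pdivrMl // mulrC.
    by apply: le_trans (expR_ge1Dx _); rewrite lerDr.
  apply: le_trans (ge0_ler_powR (ltW s0) _ _ h) _; rewrite ?nnegrE //.
    by rewrite mulr_ge0 ?expR_ge0 // ltW.
  rewrite powRM ?expR_ge0 ?(ltW s0) // ler_wpM2l ?powR_ge0 //.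
  by rewrite -expRM divfK ?gt_eqF.
have h2 : x ^+ j <= expR (- (j%:R * d)).
  rewrite -mulrN expRM_natl lerXn2r ?nnegrE ?expR_ge0 //.
  by apply: le_trans (expR_ge1Dx _); rewrite /d; lra.
apply: le_trans (ler_pM _ _ h1 h2) _; rewrite ?powR_ge0 ?exprn_ge0 //.
rewrite -mulrA -expRD ler_wpM2l ?powR_ge0 // ler_expR -natr1 /d.
by lra.
Qed.

(** One factor [x^j] of [x^(2j)] absorbs the weight by [powR_geom_le]; the other sums to at most
    [1 / (1 - x)]. *)
Lemma sum_powR_geom_le s : 0 < s -> exists2 C : R, 0 < C &
  forall x N, 0 <= x < 1 ->
    \sum_(j < N) j.+1%:R `^ s * x ^+ (j * 2) <= C * (1 - x) `^ (- (s + 1)).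
Proof.
move=> s0; have [C C0 hC] := powR_geom_le s0; exists C => // x N hx.
have d0 : 0 < 1 - x by rewrite subr_gt0; case/andP: hx.
rewrite opprD powRD ?(gt_eqF d0) ?implybT // powR_inv1 ?(ltW d0) // mulrA.
apply: le_trans (ler_wpM2l _ (ler_sum_geom N hx)); last first.
  by rewrite mulr_ge0 ?powR_ge0 ?(ltW C0).
rewrite mulr_sumr; apply: ler_sum => j _.
rewrite muln2 -addnn exprD mulrA ler_wpM2r ?exprn_ge0 //; first by case/andP: hx.
exact: hC.
Qed.

(** Sum the weighted mean inequality [2 u v <= (Y / X) u^2 + (X / Y) v^2] over the indices. *)
Lemma ler_cauchy_schwarz N (u v : 'I_N -> R) X Y : 0 < X -> 0 < Y ->
  \sum_j u j ^+ 2 <= X ^+ 2 -> \sum_j v j ^+ 2 <= Y ^+ 2 ->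
  \sum_j u j * v j <= X * Y.
Proof.
move=> X0 Y0 hu hv.
apply: (@le_trans _ _ (2^-1 * (Y / X * \sum_j u j ^+ 2 + X / Y * \sum_j v j ^+ 2))).
  rewrite !mulr_sumr -big_split /= mulr_sumr; apply: ler_sum => j _.
  have XY : Y / X * u j ^+ 2 + X / Y * v j ^+ 2 - 2 * (u j * v j) =
      (Y * u j - X * v j) ^+ 2 / (X * Y) by field; rewrite !gt_eqF.
  have := divr_ge0 (sqr_ge0 (Y * u j - X * v j)) (ltW (mulr_gt0 X0 Y0)).
  by rewrite -XY; lra.
have h1 := ler_wpM2l (ltW (divr_gt0 Y0 X0)) hu.
have h2 := ler_wpM2l (ltW (divr_gt0 X0 Y0)) hv.
have -> : X * Y = 2^-1 * (Y / X * X ^+ 2 + X / Y * Y ^+ 2).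
  by field; rewrite !gt_eqF.
by rewrite ler_wpM2l // lerD.
Qed.

End Sums.

(** * Taylor coefficients of powers of a Moebius map *)

Section MoebiusPower.
Variable R : realType.
Local Notation C := R[i].
Implicit Types (eta rho alpha z : C) (r k : R).

(* The coefficients of [g z * (z - eta) / (1 - rho * z)], where those of [g]
   are [a]. *)
Fixpoint moebius_mul eta rho (a : nat -> C) (n : nat) : C :=
  if n is n'.+1 then rho * moebius_mul eta rho a n' + a n' - eta * a n
  else - eta * a 0%N.

(** Multiplied by [1 - rho z], a partial sum of the new series is [z - eta] times that of the old
    one, up to boundary terms; the bound on the new coefficients makes their share of these tend to
    0. *)
Lemma has_taylor_moebius_mul eta rho r (g : C -> C) a (A : R) (m : nat) :
  normc rho <= r -> 0 <= r < 1 -> has_taylor g a ->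
  (forall i, normc (moebius_mul eta rho a i) <= A * i.+1%:R ^+ m * r ^+ i) ->
  has_taylor (fun z => g z * ((z - eta) / (1 - rho * z))) (moebius_mul eta rho a).
Proof.
move=> hrho hr ga hb z hz; have := hz; rewrite unit_diskE => nz.
set b := moebius_mul eta rho a.
have rz : normc (rho * z) < 1.
  have [r0 r1] := andP hr; rewrite normcM (le_lt_trans _ nz) //.
  by rewrite ler_piMl ?normc_ge0 // (le_trans hrho) // ltW.
have nz1 : 1 - rho * z != 0.
  by rewrite -normc_gt0; have := lerB_normcB 1 (rho * z); rewrite normc1; lra.
have bz : (fun n => b n * z ^+ n) @ \oo --> 0.
  (* The exponent is [m.+1] rather than [m] because [powR_geom_le] needs a positive one. *)
  have [K K0 hK] := @powR_geom_le R m.+1%:R ltac:(by rewrite ltr0n).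
  have A0 : 0 <= A.
    by have := le_trans (normc_ge0 _) (hb 0%N); rewrite expr1n expr0 !mulr1.
  pose K' := A * (K * (1 - r) `^ (- m.+1%:R)).
  have hK' n : normc (b n) <= K'.
    apply: le_trans (hb n) _; rewrite -mulrA ler_wpM2l //.
    apply: le_trans (hK _ n hr); rewrite powR_mulrn // ler_wpM2r ?exprn_ge0 //.
      by case/andP: hr.
    by rewrite ler_weXn2l // ler1n.
  apply/cvgcP => e e0.
  have := @cvg_expr R (normc z).
  rewrite ger0_norm ?normc_ge0 // => /(_ nz) /cvgrPdist_lt.
  have K'0 : 0 <= K' by exact: le_trans (normc_ge0 _) (hK' 0%N).
  move=> /(_ (e / (K' + 1)))[|N _ hN]; first by rewrite divr_gt0 // ltr_wpDl.
  exists N => n Nn; rewrite subr0 normcM normcX.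
  have := hN n Nn; rewrite /= sub0r normrN ger0_norm ?exprn_ge0 ?normc_ge0 //.
  rewrite ltr_pdivlMr ?ltr_wpDl // => h; apply: le_lt_trans h; rewrite mulrC.
  rewrite ler_wpM2l ?exprn_ge0 ?normc_ge0 //.
  by apply: le_trans (hK' n) _; rewrite lerDl.
have az : (fun n => a n * z ^+ n) @ \oo --> 0.
  by apply: cvg_series_cvg_0; exact: cvgP (ga z hz).
have step n : (1 - rho * z) * series (fun n => b n * z ^+ n) n.+1 =
    (z - eta) * series (fun n => a n * z ^+ n) n.+1
    - (a n * z ^+ n + rho * (b n * z ^+ n)) * z.
  elim: n => [|n IHn].
    by rewrite /series /= !big_nat1 expr0 /b /=; ring.
  by rewrite !(seriesSr _ n.+1) !mulrDr IHn /b /= !exprS; ring.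
rewrite -cvg_shiftS /=.
have -> : (fun n => series (fun n => b n * z ^+ n) n.+1) =
   (fun n => ((z - eta) * series (fun n => a n * z ^+ n) n.+1
    - (a n * z ^+ n + rho * (b n * z ^+ n)) * z) / (1 - rho * z)).
  by apply/funext => n; rewrite -step mulrAC divff // mul1r.
have -> : g z * ((z - eta) / (1 - rho * z)) =
  ((z - eta) * g z - (0 + rho * 0) * z) / (1 - rho * z) by field.
apply: cvgMr_tmp; apply: cvgB.
  apply: cvgMl_tmp; have := ga z hz.
  by rewrite -(cvg_shiftS (series (fun n => a n * z ^+ n))).
by apply: cvgMr_tmp; apply: cvgD az _; apply: cvgMl_tmp bz.
Qed.

(** The coefficients are [- eta] and [1 - rho eta], then each is [rho] times the previous one;
    [1 + r <= 4 r] because [r >= 1/2]. *)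
Lemma moebius_mul1_le eta rho r i : normc eta = 1 -> normc rho <= r ->
  2^-1 <= r <= 1 ->
  normc (moebius_mul eta rho (fun n => (1 : {poly C})`_n) i) <= 4 * r ^+ i.
Proof.
move=> heta hrho hr; elim: i => [|[|i] IHi].
- by rewrite /= coef1 mulr1 normcN heta; lra.
- rewrite /= !coef1 /= !mulr1 mulr0 subr0 mulrN.
  apply: le_trans (ler_normcD _ _) _; rewrite normcN normcM heta mulr1 normc1.
  by lra.
- set b := moebius_mul _ _ _ in IHi *.
  rewrite -[b i.+2]/(rho * b i.+1 + (1 : {poly C})`_i.+1 - eta * (1 : {poly C})`_i.+2) !coef1 /=.
  by rewrite mulr0 subr0 addr0 normcM exprS mulrCA ler_pM ?normc_ge0.
Qed.

(** The recursion adds two old coefficients to [rho] times the previous new one; accumulating them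
    over [i] steps costs one more power of [i + 1]. *)
Lemma moebius_mul_le eta rho r (a : nat -> C) (A : R) (m : nat) :
  normc eta = 1 -> normc rho <= r -> 2^-1 <= r <= 1 ->
  (forall i, normc (a i) <= A * i.+1%:R ^+ m * r ^+ i) ->
  forall i,
    normc (moebius_mul eta rho a i) <= 3 * A * i.+1%:R ^+ m.+1 * r ^+ i.
Proof.
move=> heta hrho hr ha; have r0 : 0 <= r by lra.
have A0 : 0 <= A.
  by have := le_trans (normc_ge0 _) (ha 0%N); rewrite expr1n expr0 !mulr1.
elim=> [|i IHi].
  rewrite /= normcM normcN heta mul1r (le_trans (ha 0%N)) //.
  by rewrite !expr1n expr0; lra.
rewrite [moebius_mul _ _ _ _]/=.
apply: le_trans (ler_normcB _ _) _; rewrite [normc (_ * a _)]normcM heta mul1r.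
apply: le_trans (lerD (ler_normcD _ _) (lexx _)) _; rewrite normcM.
have h1 := ler_pM (normc_ge0 _) (normc_ge0 _) hrho IHi.
have h2 := ha i; have h3 := ha i.+1.
apply: le_trans (lerD (lerD h1 h2) h3) _.
set p := i.+1%:R : R; set q := i.+2%:R : R.
have pq : q = p + 1 by rewrite /p /q -[in LHS]addn1 natrD.
have p0 : 0 <= p by [].
have pmq : p ^+ m <= q ^+ m by rewrite lerXn2r ?nnegrE ?pq //; lra.
have t0 : 0 <= A * r ^+ i by rewrite mulr_ge0 ?exprn_ge0.
have -> : r * (3 * A * p ^+ m.+1 * r ^+ i) + A * p ^+ m * r ^+ i +
    A * q ^+ m * r ^+ i.+1 =
    (A * r ^+ i) * (r * (3 * p * p ^+ m) + p ^+ m + r * q ^+ m).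
  by rewrite !exprS; ring.
have -> : 3 * A * q ^+ m.+1 * r ^+ i.+1 = (A * r ^+ i) * (r * (3 * q * q ^+ m)).
  by rewrite !exprS; ring.
rewrite ler_wpM2l //.
(* Here [r >= 1/2] supplies the missing factor [r] at the cost of a 2. Since [q = p + 1], the three
   terms then add up to exactly [3 r q q^m]. *)
have h5 : p ^+ m <= r * (2 * q ^+ m).
  apply: le_trans pmq _; have := exprn_ge0 m (_ : 0 <= q).
  by move=> /(_ ltac:(lra)) q0; nra.
have h4 : r * (3 * p * p ^+ m) <= r * (3 * p * q ^+ m).
  by rewrite ler_wpM2l // ler_wpM2l // mulr_ge0.
by rewrite pq in h5 h4 *; lra.
Qed.

Lemma has_taylor_moebius_exp eta rho r j : normc eta = 1 -> normc rho <= r ->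
  2^-1 <= r < 1 -> exists2 b : nat -> C,
    has_taylor (fun z => ((z - eta) / (1 - rho * z)) ^+ j.+1) b &
    forall i, normc (b i) <= 4 * 3 ^+ j * i.+1%:R ^+ j * r ^+ i.
Proof.
move=> heta hrho hr; have hr1 : 2^-1 <= r <= 1 by lra.
have hr0 : 0 <= r < 1 by lra.
elim: j => [|j [b fb hb]].
  have h i := moebius_mul1_le i heta hrho hr1.
  exists (moebius_mul eta rho (fun n => (1 : {poly C})`_n)) => [|i]; last first.
    by rewrite !expr0 !mulr1.
  have f1 : has_taylor (fun=> 1) (fun n => (1 : {poly C})`_n).
    by apply: has_taylor_eq (has_taylor_poly (p := 1)) => z _; rewrite hornerE.
  apply: has_taylor_eq (has_taylor_moebius_mul (A := 4) (m := 0) hrho hr0 f1 _).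
    by move=> z _; rewrite mul1r expr1.
  by move=> i; rewrite expr0 mulr1.
have h := moebius_mul_le heta hrho hr1 hb.
exists (moebius_mul eta rho b) => [|i].
  under eq_fun do rewrite exprSr.
  exact: has_taylor_moebius_mul hrho hr0 fb h.
by rewrite (exprS 3) mulrCA; exact: h.
Qed.

End MoebiusPower.

(** * Norms of polynomials in a Moebius map, and a Lipschitz estimate on smaller disks *)

Section MoebiusNorm.
Variable R : realType.
Local Notation C := R[i].
Implicit Types (eta rho alpha z : C) (k c nu : R) (a : nat -> C).

(** The factor [alpha] contributes [k^(2j + 2)], and the sum of [(i + 1)^(2j + 2 nu) r^(2i)] with
    [1 - r = c k] contributes [k^(-(2j + 2 nu + 1))]: the exponents add up to [1 - 2 nu] whatever
    [j] is. The constant is chosen before [k], which will be [mu^n]. *)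
Lemma sqnorm_le_moebius_exp nu c j : 0 < c <= 2^-1 -> 0 < 2 * j%:R + 2 * nu ->
  exists2 K : R, 0 <= K & forall k eta rho alpha, 0 < k <= 1 ->
    normc eta = 1 -> normc rho <= 1 - c * k -> normc alpha <= 2 * k ->
    exists2 a, has_taylor
      (fun z => (alpha * ((z - eta) / (1 - rho * z))) ^+ j.+1) a &
      sqnorm_le nu a (K * k `^ (1 - 2 * nu)).
Proof.
move=> hc s0; have [K K0 hK] := sum_powR_geom_le s0.
set s := 2 * j%:R + 2 * nu in s0 hK *.
pose L : R := (2 ^+ j.+1 * (4 * 3 ^+ j)) ^+ 2.
have c0 : 0 < c by case/andP: hc.
exists (L * (K * c `^ (- (s + 1)))) => [|k eta rho alpha /andP[k0 k1] heta hrho halpha].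
  by rewrite mulr_ge0 ?sqr_ge0 // mulr_ge0 ?powR_ge0 // ltW.
have ck : 0 < c * k <= 2^-1.
  rewrite mulr_gt0 //=; apply: (@le_trans _ _ (2^-1 * 1)); last by rewrite mulr1.
  by rewrite ler_pM ?(ltW c0) ?(ltW k0) //; case/andP: hc.
have hr : 2^-1 <= 1 - c * k < 1 by lra.
have [b fb hb] := has_taylor_moebius_exp j heta hrho hr.
exists (fun n => alpha ^+ j.+1 * b n) => [|N].
  by under eq_fun do rewrite exprMn; exact: has_taylorZ.
set r := 1 - c * k in hr hb.
apply: (@le_trans _ _ (L * k ^+ (j.+1 * 2) *
    \sum_(i < N) i.+1%:R `^ s * r ^+ (i * 2))).
  rewrite mulr_sumr; apply: ler_sum => i _.
  rewrite normcM normcX exprMn.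
  have h1 : (normc alpha ^+ j.+1) ^+ 2 <= ((2 * k) ^+ j.+1) ^+ 2.
    rewrite lerXn2r ?nnegrE ?exprn_ge0 ?normc_ge0 ?mulr_ge0 ?(ltW k0) //.
    by rewrite lerXn2r ?nnegrE ?normc_ge0 ?mulr_ge0 ?(ltW k0).
  have h2 : normc (b i) ^+ 2 <= (4 * 3 ^+ j * i.+1%:R ^+ j * r ^+ i) ^+ 2.
    rewrite lerXn2r ?nnegrE ?normc_ge0 //.
    exact: le_trans (normc_ge0 _) (hb i).
  apply: le_trans (ler_wpM2r (powR_ge0 _ _) (ler_pM (sqr_ge0 _) (sqr_ge0 _) h1 h2)) _.
  rewrite /s powRD; last by rewrite pnatr_eq0 implybT.
  rewrite -natrM powR_mulrn // mulnC !exprM /L !exprMn.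
  by apply: eq_ler; ring.
have hr0 : 0 <= r < 1 by lra.
have L0 : 0 <= L * k ^+ (j.+1 * 2).
  by rewrite mulr_ge0 ?exprn_ge0 ?sqr_ge0 // ltW.
apply: le_trans (ler_wpM2l L0 (hK r N hr0)) _.
have -> : 1 - r = c * k by rewrite /r; ring.
rewrite powRM ?(ltW c0) ?(ltW k0) //.
have -> : k `^ (1 - 2 * nu) = k ^+ (j.+1 * 2) * k `^ (- (s + 1)).
  rewrite -powR_mulrn ?(ltW k0) // -powRD ?(gt_eqF k0) ?implybT //.
  by congr (_ `^ _); rewrite /s natrM -natr1; ring.
by apply: eq_ler; ring.
Qed.

(** Induction on [s] in Horner form: in [s * 'X + d] the factor ['X] raises the exponent of the
    Moebius map, so [j] is kept general. *)
Lemma sqnorm_le_poly_moebius nu c (s : {poly C}) j :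
  0 < c <= 2^-1 -> 0 < 2 * j%:R + 2 * nu ->
  exists2 K : R, 0 <= K & forall k eta rho alpha, 0 < k <= 1 ->
    normc eta = 1 -> normc rho <= 1 - c * k -> normc alpha <= 2 * k ->
    exists2 a, has_taylor
      (fun z => s.[alpha * ((z - eta) / (1 - rho * z))] *
                (alpha * ((z - eta) / (1 - rho * z))) ^+ j.+1) a &
      sqnorm_le nu a (K * k `^ (1 - 2 * nu)).
Proof.
move=> hc; elim/poly_ind: s j => [|s d IHs] j hj.
  exists 0 => // k eta rho alpha _ _ _ _; exists (fun=> 0) => [|N].
    have : has_taylor (fun=> 0) (fun n => (0 : {poly C})`_n).
      by apply: has_taylor_eq (has_taylor_poly (p := 0)) => z _; rewrite hornerE.
    rewrite (_ : (fun n => _) = fun=> 0); last by apply/funext => n; rewrite coef0.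
    by apply: has_taylor_eq => z _; rewrite horner0 mul0r.
  by rewrite mul0r big1 // => i _; rewrite normc0 expr0n mul0r.
have [|K K0 hK] := IHs j.+1; first by rewrite -natr1; lra.
have [L L0 hL] := sqnorm_le_moebius_exp hc hj.
exists (2 * K + 2 * (normc d ^+ 2 * L)) => [|k eta rho alpha hk heta hrho halpha].
  by rewrite addr_ge0 // mulr_ge0 // mulr_ge0 ?sqr_ge0.
have [a fa ha] := hK k eta rho alpha hk heta hrho halpha.
have [b fb hb] := hL k eta rho alpha hk heta hrho halpha.
exists (fun n => a n + d * b n); last first.
  rewrite mulrDl -!mulrA; apply: sqnorm_leD ha _.
  by rewrite mulrA; apply: sqnorm_leZ.
apply: has_taylor_eq (has_taylorD fa (has_taylorZ (c := d) fb)) => z _.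
set v := alpha * _; rewrite hornerMXaddC (exprS v j.+1).
by ring.
Qed.

Lemma sqnorm_le_nuW nu nu' a (A : R) : nu' <= nu ->
  sqnorm_le nu a A -> sqnorm_le nu' a A.
Proof.
move=> hnu ha N; apply: le_trans (ha N); apply: ler_sum => i _.
by rewrite ler_wpM2l ?sqr_ge0 // ler_powR ?ler1n // ler_pM2l.
Qed.

Lemma normc_subrXX (p q : C) (r : R) j : normc p <= r -> normc q <= r ->
  normc (p ^+ j.+1 - q ^+ j.+1) <= normc (p - q) * (j.+1%:R * r ^+ j).
Proof.
move=> hp hq; rewrite subrXX normcM ler_wpM2l ?normc_ge0 //.
apply: le_trans (ler_normc_sum _ _) _.
apply: (@le_trans _ _ (\sum_(i < j.+1) r ^+ j)); last first.
  by rewrite sumr_const card_ord mulr_natl.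
apply: ler_sum => i _; rewrite normcM !normcX.
have -> : r ^+ j = r ^+ (j.+1.-1 - i) * r ^+ i.
  by rewrite -exprD /= subnK // -ltnS.
have r0 := le_trans (normc_ge0 _) hp.
by rewrite ler_pM ?exprn_ge0 ?normc_ge0 ?lerXn2r ?nnegrE ?normc_ge0 ?exprn_ge0.
Qed.

(** Termwise, [|p^i - q^i| <= |p - q| i r^(i - 1)]. Cauchy-Schwarz splits the weight [i + 1] into
    [(i + 1)^nu], paired with the coefficients, and [(i + 1)^(1 - nu)], paired with [r^i]; the
    latter squares sum to the power of [1 - r]. *)
Lemma dirichlet_lipschitz nu : nu < 1 -> exists2 K : R, 0 < K &
  forall h a X p q r, has_taylor h a -> 0 < X -> sqnorm_le nu a (X ^+ 2) ->
    2^-1 <= r < 1 -> normc p <= r -> normc q <= r ->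
    normc (h p - h q) <= K * X * normc (p - q) * (1 - r) `^ (- ((3 - 2 * nu) / 2)).
Proof.
move=> nu1; have s0 : 0 < 2 - 2 * nu by lra.
have [K K0 hK] := sum_powR_geom_le s0.
exists (2 * Num.sqrt K) => [|h a X p q r ha X0 hX hr hp hq].
  by rewrite mulr_gt0 ?sqrtr_gt0.
have r1 : 0 < 1 - r by lra.
have hr0 : 0 <= r < 1 by lra.
set Y := Num.sqrt K * (1 - r) `^ (- ((3 - 2 * nu) / 2)).
have Y0 : 0 < Y by rewrite mulr_gt0 ?sqrtr_gt0 ?powR_gt0.
have Y2 : Y ^+ 2 = K * (1 - r) `^ (- (2 - 2 * nu + 1)).
  rewrite exprMn sqr_sqrtr ?(ltW K0) // -(powR_mulrn 2) ?powR_ge0 // -powRrM.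
  by congr (_ * _ `^ _); field.
apply/ler_addgt0Pr => e e0.
have dp : normc p < 1 by lra.
have dq : normc q < 1 by lra.
have /cvgcP/(_ _ e0)[N hN] : (series (fun n => a n * p ^+ n) \-
    series (fun n => a n * q ^+ n)) @ \oo --> h p - h q.
  by apply: cvgB; apply: ha; rewrite unit_diskE.
have {hN} := hN N (leqnn _); rewrite normcBC => hN.
have -> : h p - h q = (h p - h q - (series (fun n => a n * p ^+ n) N -
    series (fun n => a n * q ^+ n) N)) +
    \sum_(i < N) a i * (p ^+ i - q ^+ i).
  rewrite (eq_bigr (fun i : 'I_N => a i * p ^+ i - a i * q ^+ i)) => [|i _].
    by rewrite sumrB /series /= !big_mkord subrK.
  by rewrite mulrBr.
apply: le_trans (ler_normcD _ _) _; rewrite addrC lerD ?(ltW hN) //.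
apply: le_trans (ler_normc_sum _ _) _.
have -> : 2 * Num.sqrt K * X * normc (p - q) *
  (1 - r) `^ (- ((3 - 2 * nu) / 2)) = 2 * normc (p - q) * (X * Y).
  by rewrite /Y; ring.
have hY : \sum_(i < N) (i.+1%:R `^ (1 - nu) * r ^+ i) ^+ 2 <= Y ^+ 2.
  rewrite Y2; apply: le_trans (hK r N hr0); apply: ler_sum => i _.
  rewrite exprMn -exprM -(powR_mulrn 2) ?powR_ge0 // -powRrM.
  by apply: eq_ler; congr (_ `^ _ * _); ring.
have hX' : \sum_(i < N) (normc (a i) * i.+1%:R `^ nu) ^+ 2 <= X ^+ 2.
  apply: le_trans (hX N); apply: ler_sum => i _.
  rewrite exprMn -(powR_mulrn 2 (powR_ge0 _ nu)) -powRrM.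
  by apply: eq_ler; congr (_ * _ `^ _); rewrite mulrC.
have pq0 : 0 <= 2 * normc (p - q) by rewrite mulr_ge0 ?normc_ge0.
apply: le_trans _ (ler_wpM2l pq0 (ler_cauchy_schwarz X0 Y0 hX' hY)).
rewrite mulr_sumr; apply: ler_sum => -[i hi] _ /=; rewrite normcM.
have -> : normc (a i) * i.+1%:R `^ nu * (i.+1%:R `^ (1 - nu) * r ^+ i) =
    normc (a i) * (i.+1%:R * r ^+ i).
  rewrite -!mulrA [i.+1%:R `^ nu * _]mulrA -powRD ?pnatr_eq0 ?implybT //.
  by rewrite addrCA subrr addr0 powRr1.
rewrite mulrCA ler_wpM2l ?normc_ge0 //.
case: i {hi} => [|i]; first by rewrite subrr normc0 !mulr_ge0 ?normc_ge0 ?exprn_ge0 //; lra.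
(* As [r >= 1/2], [r^i <= 2 r^(i + 1)]: this is the origin of the factor 2. *)
apply: le_trans (normc_subrXX i hp hq) _.
rewrite -mulrA mulrCA ler_wpM2l ?normc_ge0 // exprS mulrCA [in leRHS]mulrCA.
have : i.+1%:R <= i.+2%:R :> R by rewrite ler_nat.
have : 0 <= i.+1%:R :> R by [].
have : 0 <= r ^+ i by rewrite exprn_ge0; lra.
set u := r ^+ i; set v := i.+1%:R; set w := i.+2%:R => u0 v0 vw.
have h1 : v * u <= w * u by rewrite ler_wpM2r.
have h2 : 0 <= w * u by rewrite mulr_ge0 // (le_trans v0).
by nra.
Qed.

End MoebiusNorm.

(** * Density of the polynomials divisible by a power of [z - eta] *)

Section Density.
Variable R : realType.
Local Notation C := R[i].
Implicit Types (nu e : R) (eta : C) (p q h : {poly C}).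

(** Cut where the partial sum comes within [e] of the supremum of all partial sums; what remains is
    a difference [S M - S N]. *)
Lemma sqnorm_le_truncation nu (a : nat -> C) (A e : R) :
  sqnorm_le nu a A -> 0 < e ->
  exists p : {poly C}, sqnorm_le nu (fun n => a n - p`_n) e.
Proof.
move=> ha e0.
pose S N : R := \sum_(n < N) normc (a n) ^+ 2 * n.+1%:R `^ (2 * nu).
have hS : has_sup (range S).
  by split; [exists (S 0%N), 0%N | exists A => _ [N _ <-]; exact: ha].
have [_ [N _ <-] hN] := sup_adherent e0 hS.
exists (\poly_(i < N) a i) => M.
have term (n : nat) : normc (a n - (\poly_(i < N) a i)`_n) ^+ 2 =
    if (n < N)%N then 0 else normc (a n) ^+ 2.
  by rewrite coef_poly; case: ifP; rewrite ?subrr ?normc0 ?expr0n ?subr0.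
have [MN|NM] := leqP M N.
  rewrite big1 ?(ltW e0) // => i _.
  by rewrite term (leq_trans (ltn_ord i) MN) mul0r.
have SM : S M <= sup (range S) by apply: ub_le_sup; [case: hS | exists M].
suff : \sum_(n < M) normc (a n - (\poly_(i < N) a i)`_n) ^+ 2 *
    n.+1%:R `^ (2 * nu) = S M - S N by lra.
pose F (n : nat) : R := normc (a n) ^+ 2 * n.+1%:R `^ (2 * nu).
rewrite /S -(big_mkord xpredT F) (big_cat_nat (leq0n N) (ltnW NM)) /=.
rewrite (big_mkord xpredT F) addrC addrK -(big_mkord xpredT
  (fun n => normc (a n - (\poly_(i < N) a i)`_n) ^+ 2 * n.+1%:R `^ (2 * nu))).
rewrite (big_cat_nat (leq0n N) (ltnW NM)) /= big_nat_cond big1 ?add0r => [|i].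
  by apply: eq_big_nat => i /andP[Ni _]; rewrite term ltnNge Ni.
by rewrite andbT term => /andP[_ ->]; rewrite mul0r.
Qed.

Lemma powR_succ_le nu (i : nat) :
  i.+2%:R `^ nu <= 2 `^ `|nu| * i.+1%:R `^ nu :> R.
Proof.
have i1 : (0 : R) < i.+1%:R by rewrite ltr0n.
have i2 : (0 : R) < i.+2%:R by rewrite ltr0n.
have [nu0|nu0] := leP 0 nu.
  rewrite ger0_norm // -powRM // ge0_ler_powR ?nnegrE ?mulr_ge0 //.
  by rewrite -natrM ler_nat mul2n -addnn addSn ltnS leq_addl.
have -> : nu = - `|nu| by rewrite ltr0_norm ?opprK.
rewrite normrN normr_id !powRN -[leLHS]mul1r ler_pM ?invr_ge0 ?powR_ge0 //.
  by rewrite -[leLHS](powRr0 2) ler_powR ?ler1n.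
by rewrite lef_pV2 ?posrE ?powR_gt0 // ge0_ler_powR ?nnegrE ?ler_nat.
Qed.

Lemma sqnorm_le_mulX nu h (B : R) : sqnorm_le nu (fun n => h`_n) B ->
  sqnorm_le nu (fun n => (h * 'X)`_n) (2 `^ `|2 * nu| * B).
Proof.
move=> hB [|N].
  by rewrite big_ord0 mulr_ge0 ?powR_ge0 // (sqnorm_le_ge0 hB).
rewrite big_ord_recl (_ : (h * 'X)`_ord0 = 0) ?coefMX //.
rewrite normc0 expr0n mul0r add0r.
apply: le_trans (ler_wpM2l (powR_ge0 _ _) (hB N)).
rewrite mulr_sumr; apply: ler_sum => i _; rewrite coefMX /=.
by rewrite mulrCA ler_wpM2l ?sqr_ge0 //; exact: powR_succ_le.
Qed.

(** Horner's scheme reduces multiplication by [p] to scalars and multiplications by ['X], which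
    change the weights by a bounded factor. *)
Lemma sqnorm_le_mul nu p : exists2 K : R, 0 <= K & forall h (B : R),
  sqnorm_le nu (fun n => h`_n) B -> sqnorm_le nu (fun n => (p * h)`_n) (K * B).
Proof.
elim/poly_ind: p => [|p c [K K0 IHp]].
  exists 0 => // h B _ N; rewrite mul0r big1 ?mul0r // => i _.
  by rewrite coef0 normc0 expr0n mul0r.
exists (2 * (2 `^ `|2 * nu| * K) + 2 * normc c ^+ 2) => [|h B hB].
  by rewrite addr_ge0 // mulr_ge0 ?sqr_ge0 // mulr_ge0 ?powR_ge0.
have hD := sqnorm_leD (sqnorm_le_mulX (IHp h B hB)) (sqnorm_leZ c hB).
apply: sqnorm_leW (eq_sqnorm_le _ hD) => [|n]; first by apply: eq_ler; ring.
by rewrite mulrDl coefD coefCM mulrAC.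
Qed.

(* [h] is a normalised partial sum of [\sum (z / eta)^k / (k + 1)], whose
   squared norm is at most the inverse of a harmonic sum. *)
Lemma sqnorm_le_interpolation nu eta e : nu <= 1 / 2 -> normc eta = 1 -> 0 < e ->
  exists2 h, h.[eta] = 1 & sqnorm_le nu (fun n => h`_n) e.
Proof.
move=> hnu heta e0.
pose H N : R := \sum_(k < N) k.+1%:R^-1.
have [N hN] : exists N, e^-1 < H N.
  apply: contrapT => hH; apply: (@dvg_harmonic R).
  apply: nondecreasing_is_cvgn.
    by apply: nondecreasing_series => n _ _; exact: harmonic_ge0.
  exists e^-1 => _ [N _ <-]; rewrite /series /= big_mkord leNgt.
  by apply/negP => h; apply: hH; exists N.
have H0 : 0 < H N by apply: lt_trans hN; rewrite invr_gt0.
have eta0 : eta != 0 by rewrite -normc_gt0 heta.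
pose g (k : nat) : C := ((H N)^-1 * k.+1%:R^-1)%:C * eta ^- k.
exists (\poly_(k < N) g k) => [|M].
  rewrite horner_poly.
  rewrite (eq_bigr (fun i : 'I_N => ((H N)^-1 * i.+1%:R^-1)%:C)); last first.
    by move=> i _; rewrite /g mulfVK // expf_neq0.
  by rewrite -rmorph_sum /= -mulr_sumr mulVf // gt_eqF.
apply: (@le_trans _ _ (H N)^-1); last first.
  by rewrite -[leRHS]invrK lef_pV2 ?posrE ?invr_gt0 // ltW.
(* As [2 nu <= 1], the weight is at most [n + 1] and cancels one of the two factors
   [1 / (n + 1)]. *)
apply: (@le_trans _ _ (\sum_(n < M | (n < N)%N) ((H N)^-1 ^+ 2 * n.+1%:R^-1))).
  rewrite [leRHS]big_mkcond /=; apply: ler_sum => i _; rewrite coef_poly.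
  case: ifP => _; last by rewrite normc0 expr0n mul0r.
  rewrite normcM normcV normcX heta expr1n invr1 mulr1 normcR ger0_norm; last first.
    by rewrite mulr_ge0 ?invr_ge0 ?ltW.
  rewrite exprMn -mulrA ler_wpM2l ?sqr_ge0 // expr2 -mulrA.
  rewrite ler_piMr ?invr_ge0 // mulrC ler_pdivrMr ?ltr0n // mul1r.
  rewrite -[leRHS]powRr1 // ler_powR ?ler1n //.
  by lra.
rewrite -mulr_sumr -[leRHS](_ : (H N)^-1 ^+ 2 * H N = _); last first.
  by rewrite expr2 mulfVK // gt_eqF.
rewrite ler_wpM2l ?sqr_ge0 // /H.
pose F (n : nat) : R := n.+1%:R^-1.
rewrite (big_ord_widen_cond (M + N) (fun n => n < N)%N F) ?leq_addr //.
rewrite [leRHS](big_ord_widen (M + N) F) ?leq_addl //.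
rewrite big_mkcond [leRHS]big_mkcond; apply: ler_sum => i _.
by case: (i < N)%N => //=; case: ifP => // _; rewrite invr_ge0.
Qed.

(** To gain a factor ['X - eta%:P], multiply the current approximant by [1 - h] with [h.[eta] = 1].
    The change is the approximant times [h], small when [h] is, because multiplication by a fixed
    polynomial is bounded. *)
Lemma sqnorm_le_density nu eta p m e : nu <= 1 / 2 -> normc eta = 1 -> 0 < e ->
  exists r : {poly C},
    sqnorm_le nu (fun n => (p - r * ('X - eta%:P) ^+ m)`_n) e.
Proof.
move=> hnu heta; elim: m e => [|m IHm] e e0.
  exists p => N; rewrite expr0 mulr1 subrr big1 ?ltW // => i _.
  by rewrite coef0 normc0 expr0n mul0r.
have [|r hr] := IHm (e / 4); first by rewrite divr_gt0.
have [K K0 hK] := sqnorm_le_mul nu (r * ('X - eta%:P) ^+ m).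
have [|h h1 hh] := @sqnorm_le_interpolation nu eta (e / 4 / (K + 1)) hnu heta.
  by rewrite !divr_gt0 // ltr_wpDl.
have /factor_theorem[g hg] : root (1 - h) eta.
  by rewrite rootE !hornerE h1 subrr.
exists (r * g).
have -> : p - r * g * ('X - eta%:P) ^+ m.+1 =
    (p - r * ('X - eta%:P) ^+ m) + r * ('X - eta%:P) ^+ m * h.
  have -> : r * g * ('X - eta%:P) ^+ m.+1 =
     r * ('X - eta%:P) ^+ m * (g * ('X - eta%:P)) by rewrite exprS; ring.
  by rewrite -hg; ring.
apply: eq_sqnorm_le (fun n => esym (coefD _ _ n)) _.
apply: sqnorm_leW (sqnorm_leD hr (hK _ _ hh)).
suff : K * (e / 4 / (K + 1)) <= e / 4 by lra.
rewrite mulrCA ler_piMr ?divr_ge0 ?(ltW e0) //.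
by rewrite ler_pdivrMr ?ltr_wpDl // mul1r lerDl.
Qed.

End Density.

(** * The hyperbolic flow with fixed points on the unit circle *)

Section HyperbolicFlow.
Variable R : realType.
Local Notation C := R[i].
Implicit Types (eta z u v : C) (k l : R).

Definition flow_den eta eta' k z := (1 - k%:C) * z - eta' + k%:C * eta.

(* The solution [u] of [(u - eta) / (u - eta') = k (z - eta) / (z - eta')]. *)
Definition flow eta eta' k z :=
  ((eta - k%:C * eta') * z - (1 - k%:C) * eta * eta') / flow_den eta eta' k z.

Lemma flow_cross eta eta' k z u : flow_den eta eta' k z != 0 ->
  (u - eta) * (z - eta') = k%:C * (z - eta) * (u - eta') <->
  u = flow eta eta' k z.
Proof.
move=> den0; rewrite /flow; split=> [h|->]; last first.
  by move: den0; rewrite /flow_den => den0; field.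
apply: (mulIf den0); rewrite mulfVK // /flow_den; apply/eqP.
rewrite -subr_eq0; move/eqP: h; rewrite -subr_eq0 => /eqP <-.
by apply/eqP; ring.
Qed.

Section UnitFixpoints.
Variables eta eta' : C.
Hypotheses (heta : normc eta = 1) (heta' : normc eta' = 1) (neq : eta != eta').

Let dist_gt0 : 0 < normc (eta - eta') ^+ 2.
Proof. by rewrite exprn_gt0 // normc_gt0 subr_eq0. Qed.

(** An identity in real coordinates modulo [|eta| = |eta'| = 1]. It shows that the disk is invariant
    and bounds from below the distance of the images to the circle. *)
Lemma flow_norm_identity k z :
  normc (flow_den eta eta' k z) ^+ 2 -
  normc ((eta - k%:C * eta') * z - (1 - k%:C) * eta * eta') ^+ 2 =
  k * normc (eta - eta') ^+ 2 * (1 - normc z ^+ 2).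
Proof.
rewrite /flow_den; move: heta heta' => /(congr1 (fun x => x ^+ 2)).
rewrite expr1n => h /(congr1 (fun x => x ^+ 2)); rewrite expr1n; move: h.
rewrite !sqr_normcE.
case: eta => a b; case: eta' => c d; case: z => x y /=.
set s := a ^+ 2 + b ^+ 2; set s' := c ^+ 2 + d ^+ 2 => hs hs'.
apply/eqP; rewrite -subr_eq0; apply/eqP.
(* Every summand vanishes when [s = s' = 1]. *)
rewrite [LHS](_ : _ =
  (x ^+ 2 + y ^+ 2) * ((1 - s) * (1 - k) + (k ^+ 2 - k) * (1 - s')) +
  2 * (1 - k) * ((s - 1) * (x * c + y * d) + k * (1 - s') * (x * a + y * b)) +
  (1 - k) * (s' - k * s - (1 - k) * s * s')); last by rewrite /s /s'; ring.
by rewrite hs hs'; ring.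
Qed.

Lemma sqr_normc_pole k : normc (eta' - k%:C * eta) ^+ 2 =
  (1 - k) ^+ 2 + k * normc (eta - eta') ^+ 2.
Proof.
move: heta heta' => /(congr1 (fun x => x ^+ 2)).
rewrite expr1n => h /(congr1 (fun x => x ^+ 2)); rewrite expr1n; move: h.
rewrite !sqr_normcE; case: eta => a b; case: eta' => c d /=.
set s := a ^+ 2 + b ^+ 2; set s' := c ^+ 2 + d ^+ 2 => hs hs'.
rewrite [LHS](_ : _ = k ^+ 2 * s + s' - 2 * k * (a * c + b * d)); last first.
  by rewrite /s /s'; ring.
rewrite [in RHS](_ : _ + _ = s + s' - 2 * (a * c + b * d)); last first.
  by rewrite /s /s'; ring.
by rewrite hs hs'; ring.
Qed.

Lemma sqr_dist_le4 : normc (eta - eta') ^+ 2 <= 4.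
Proof.
have := ler_normcB eta eta'; rewrite heta heta'.
by have := normc_ge0 (eta - eta'); nra.
Qed.

Variable k : R.
Hypothesis hk : 0 < k <= 1.

Let k_gt0 : 0 < k. Proof. by case/andP: hk. Qed.

Let D := (1 - k) ^+ 2 + k * normc (eta - eta') ^+ 2.

Lemma pole_ge : normc (eta - eta') ^+ 2 / 4 <= D.
Proof.
rewrite /D; set X := normc _ ^+ 2; have X0 : 0 <= X by exact: sqr_ge0.
have X4 : 0 <= 4 - X by rewrite subr_ge0; exact: sqr_dist_le4.
(* From [(1 - k)^2 >= X (1 - k)^2 / 4] one gets [D >= X (1 + k)^2 / 4]. *)
have := mulr_ge0 X4 (sqr_ge0 (1 - k)).
have := mulr_ge0 X0 (ltW k_gt0); have := mulr_ge0 X0 (sqr_ge0 k).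
by lra.
Qed.

Lemma pole_le : D <= 4.
Proof.
have [k0 k1] := andP hk; have := ler_wpM2l (ltW k0) sqr_dist_le4.
by rewrite /D; nra.
Qed.

Lemma pole_gt0 : 0 < D.
Proof. by apply: lt_le_trans pole_ge; rewrite divr_gt0. Qed.

Lemma pole_neq0 : eta' - k%:C * eta != 0.
Proof.
rewrite -normc_gt0 lt_def normc_ge0 andbT -sqrf_eq0 sqr_normc_pole.
by rewrite gt_eqF // pole_gt0.
Qed.

Lemma flow_den_neq0 z : normc z < 1 -> flow_den eta eta' k z != 0.
Proof.
move=> hz; rewrite -normc_gt0 lt_def normc_ge0 andbT -sqrf_eq0 gt_eqF //.
have h := flow_norm_identity k z; have := normc_ge0 z.
rewrite -(subrK (normc ((eta - k%:C * eta') * z - (1 - k%:C) * eta * eta') ^+ 2)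
  (normc (flow_den eta eta' k z) ^+ 2)) h => z0.
have z1 : 0 < 1 - normc z ^+ 2 by rewrite subr_gt0 expr_lt1.
by rewrite ltr_pwDl ?sqr_ge0 //; apply: mulr_gt0 z1; exact: mulr_gt0.
Qed.

(** Divide [flow_norm_identity] by the squared modulus of the denominator, which is at most 4. *)
Lemma flow_defect z : normc z < 1 ->
  k * normc (eta - eta') ^+ 2 * (1 - normc z ^+ 2) / 4 <=
  1 - normc (flow eta eta' k z) ^+ 2.
Proof.
move=> hz; have den0 := flow_den_neq0 hz; have h := flow_norm_identity k z.
have dgt : 0 < normc (flow_den eta eta' k z) ^+ 2 by rewrite exprn_gt0 // normc_gt0.
have dle : normc (flow_den eta eta' k z) ^+ 2 <= 4.
  have -> : 4 = 2 ^+ 2 :> R by ring.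
  rewrite lerXn2r ?nnegrE ?normc_ge0 //.
  apply: le_trans (ler_normcD _ _) _; rewrite normcM normcR gtr0_norm // heta.
  have := ler_normcB ((1 - k%:C) * z) eta'; rewrite normcM heta'.
  have -> : 1 - k%:C = (1 - k)%:C :> C by rewrite rmorphB.
  have k1 : 0 <= 1 - k by rewrite subr_ge0; case/andP: hk.
  rewrite normcR ger0_norm //.
  by have := ler_wpM2l k1 (ltW hz); lra.
rewrite /flow normcM normcV exprMn exprVn.
set N2 := normc (_ - _ * eta * eta') ^+ 2 in h *.
set D2 := normc (flow_den _ _ _ _) ^+ 2 in h dgt dle *.
have -> : 1 - N2 / D2 = (D2 - N2) / D2.
  by field; rewrite gt_eqF.
have z1 : 0 <= 1 - normc z ^+ 2 by rewrite subr_ge0 expr_le1 ?normc_ge0 // ltW.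
rewrite h ler_wpM2l ?lef_pV2 ?posrE //.
by apply: mulr_ge0 z1; rewrite mulr_ge0 ?sqr_ge0 ?(ltW k_gt0).
Qed.

Lemma flow_le z : normc z < 1 -> normc (flow eta eta' k z) <=
  1 - normc (eta - eta') ^+ 2 * (1 - normc z ^+ 2) / 8 * k.
Proof.
move=> hz; have := flow_defect hz.
set n := normc (flow _ _ _ _); set X := _ * (1 - _) => h.
(* The square gives [1 - n^2 <= 2 (1 - n)], which turns the 4 into an 8. *)
by have := sqr_ge0 (1 - n); move: h; rewrite /X; nra.
Qed.

Lemma flow_lt1 z : normc z < 1 -> normc (flow eta eta' k z) < 1.
Proof.
move=> hz; apply: le_lt_trans (flow_le hz) _.
have z1 : 0 < 1 - normc z ^+ 2 by rewrite subr_gt0 expr_lt1 ?normc_ge0.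
by rewrite gtrBl mulr_gt0 // divr_gt0 //; exact: mulr_gt0.
Qed.

(** These are [alpha] and [rho] in the Moebius form of the flow; [flow_ratio] is the inverse of its
    pole, hence 0 for [k = 1]. *)
Definition flow_scale : C := k%:C * (eta - eta') / (k%:C * eta - eta').
Definition flow_ratio : C := (1 - k%:C) / (eta' - k%:C * eta).

Lemma flowE z : normc z < 1 -> flow eta eta' k z - eta =
  flow_scale * ((z - eta) / (1 - flow_ratio * z)).
Proof.
move=> hz; have den0 := flow_den_neq0 hz; have p0 := pole_neq0.
have p1 : k%:C * eta - eta' != 0 by rewrite -oppr_eq0 opprB.
have e0 : eta' - k%:C * eta - (1 - k%:C) * z != 0.
  move: den0; rewrite /flow_den -oppr_eq0; congr (_ != 0); ring.
rewrite /flow /flow_scale /flow_ratio.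
move: den0; rewrite /flow_den => den0.
by field; rewrite p0 e0 p1 den0.
Qed.

Lemma sqr_flow_ratio :
  normc flow_ratio ^+ 2 = 1 - k * normc (eta - eta') ^+ 2 / D.
Proof.
rewrite /flow_ratio normcM normcV exprMn exprVn sqr_normc_pole.
have -> : 1 - k%:C = (1 - k)%:C :> C by rewrite rmorphB.
rewrite normcR real_normK ?num_real // -/D.
have := pole_gt0; rewrite /D => D0.
by field; rewrite gt_eqF.
Qed.

Lemma flow_ratio_le :
  normc flow_ratio <= 1 - normc (eta - eta') ^+ 2 / 8 * k.
Proof.
have h := sqr_flow_ratio; have D0 := pole_gt0; have D4 := pole_le.
have : k * normc (eta - eta') ^+ 2 / 4 <= k * normc (eta - eta') ^+ 2 / D.
  by rewrite ler_wpM2l ?lef_pV2 ?posrE // mulr_ge0 ?sqr_ge0 ?ltW.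
have := sqr_ge0 (1 - normc flow_ratio).
by have := normc_ge0 flow_ratio; nra.
Qed.

Lemma flow_scale_le : normc flow_scale <= 2 * k.
Proof.
rewrite /flow_scale !normcM normcV normcR gtr0_norm //.
rewrite [normc (k%:C * _ - _)]normcBC.
have p0 := pole_neq0; rewrite -normc_gt0 in p0.
rewrite ler_pdivrMr // -mulrA mulrCA ler_wpM2l ?(ltW k_gt0) //.
rewrite -(@ler_pXn2r _ 2) ?nnegrE ?mulr_ge0 ?normc_ge0 // exprMn sqr_normc_pole.
by have := pole_ge; rewrite /D; lra.
Qed.

(** The difference times [1 - rho z] is [k (eta - eta')^2 / (eta' - k eta)^2] times [z], and this
    factor has modulus [1 - |rho|^2]. *)
Lemma flow_subr0 z : normc z < 1 ->
  normc (flow eta eta' k z - flow eta eta' k 0) * normc (1 - flow_ratio * z) =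
  (1 - normc flow_ratio ^+ 2) * normc z.
Proof.
move=> hz; have h0 : normc (0 : C) < 1 by rewrite normc0.
have -> : flow eta eta' k z - flow eta eta' k 0 =
  (flow eta eta' k z - eta) - (flow eta eta' k 0 - eta) by ring.
rewrite !flowE // mulr0 subr0 divr1 sub0r -normcM.
have den0 := flow_den_neq0 hz; have p0 := pole_neq0.
have p1 : k%:C * eta - eta' != 0 by rewrite -oppr_eq0 opprB.
have e0 : eta' - k%:C * eta - (1 - k%:C) * z != 0.
  move: den0; rewrite /flow_den -oppr_eq0; congr (_ != 0); ring.
have -> : (flow_scale * ((z - eta) / (1 - flow_ratio * z)) - flow_scale * - eta)
    * (1 - flow_ratio * z) =
    k%:C * (eta - eta') ^+ 2 / (eta' - k%:C * eta) ^+ 2 * z.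
  by rewrite /flow_scale /flow_ratio; field; rewrite p0 e0 p1.
rewrite sqr_flow_ratio !normcM normcV !normcX normcR gtr0_norm //.
by rewrite sqr_normc_pole -/D subKr.
Qed.

End UnitFixpoints.

(** By [flow_subr0] the displacement [d] satisfies [d (1 - |rho| t) <= (1 - |rho|^2) t]. The bound
    linear in [k] serves to bound the functionals uniformly; [kappa < t] separates the iterates from
    the start [k = 1]. *)
Lemma flow_contraction eta eta' mu : normc eta = 1 -> normc eta' = 1 ->
  eta != eta' -> 0 < mu < 1 ->
  exists t : R, exists2 kappa : R, [/\ 0 < t, t <= 2^-1 & kappa < t] &
    forall k, 0 < k <= 1 ->
      normc (flow eta eta' k t%:C - flow eta eta' k 0) <= 8 * k * t /\
      (k <= mu -> normc (flow eta eta' k t%:C - flow eta eta' k 0) <= kappa).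
Proof.
move=> h1 h2 neq hmu; pose x0 := (1 - mu) / 2.
have x0gt : 0 < x0 by rewrite divr_gt0 // subr_gt0; case/andP: hmu.
have x0le : x0 <= 2^-1 by rewrite /x0; lra.
(* For [k <= mu], [x0] is a lower bound of [|rho|], so [t = x0 / 2] makes
   [|rho| t <= |rho|^2 / 2]. *)
exists (x0 / 2), ((1 - x0 ^+ 2 / 2) * (x0 / 2)).
  split; [by rewrite divr_gt0 | by lra |].
  by have := mulr_gt0 (exprn_gt0 2 x0gt) x0gt; lra.
move=> k hk; set t := x0 / 2.
have t0 : 0 < t by rewrite /t; lra.
have nt : normc t%:C = t by rewrite normcR gtr0_norm.
have ht : normc t%:C < 1 by rewrite nt /t; lra.
have := flow_subr0 h1 h2 neq hk ht; rewrite nt.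
set d := normc (_ - flow _ _ _ 0); set rho := flow_ratio _ _ _ => hd.
have hrho := sqr_flow_ratio h1 h2 neq hk; rewrite -/rho in hrho.
have hrho1 := flow_ratio_le h1 h2 neq hk; rewrite -/rho in hrho1.
have dist0 := sqr_ge0 (normc (eta - eta')).
have k0 : 0 < k by case/andP: hk.
have rho0 := normc_ge0 rho.
have rho1 : normc rho <= 1.
  apply: le_trans hrho1 _.
  by rewrite gerBl mulr_ge0 ?divr_ge0 ?(ltW k0).
have den : 1 - normc rho * t <= normc (1 - rho * t%:C).
  by have := lerB_normcB 1 (rho * t%:C); rewrite normc1 normcM nt.
have d0 : 0 <= d by exact: normc_ge0.
have D0 := pole_gt0 h1 h2 neq hk.
have Dge := pole_ge h1 h2 hk; have Dle := pole_le h1 h2 hk.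
have hdle : d * (1 - normc rho * t) <= (1 - normc rho ^+ 2) * t.
  by rewrite -hd ler_wpM2l.
split.
  have q4 : 1 - normc rho ^+ 2 <= 4 * k.
    rewrite hrho subKr ler_pdivrMr //.
    have := ler_wpM2l (ltW k0) Dge; lra.
  have : normc rho * t <= 2^-1.
    by apply: le_trans (ler_wpM2r (ltW t0) rho1) _; rewrite mul1r /t; lra.
  have := ler_wpM2r (ltW t0) q4 => q5 q6.
  have : d * 2^-1 <= d * (1 - normc rho * t) by rewrite ler_wpM2l //; lra.
  by lra.
move=> kmu.
have hx : x0 <= normc rho.
  rewrite -(@ler_pXn2r _ 2) ?nnegrE ?(ltW x0gt) // hrho.
  have -> : 1 - k * normc (eta - eta') ^+ 2 /
      ((1 - k) ^+ 2 + k * normc (eta - eta') ^+ 2) =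
     (1 - k) ^+ 2 / ((1 - k) ^+ 2 + k * normc (eta - eta') ^+ 2).
    by field; rewrite gt_eqF.
  rewrite ler_pdivlMr //.
  apply: le_trans (ler_wpM2l (sqr_ge0 _) Dle) _.
  have -> : x0 ^+ 2 * 4 = (1 - mu) ^+ 2 by rewrite /x0; field.
  by rewrite lerXn2r ?nnegrE; lra.
have h3 : 2^-1 <= 1 - normc rho ^+ 2 / 2.
  have r1 : normc rho ^+ 2 <= 1 by rewrite expr_le1.
  by lra.
have h4 : d * (1 - normc rho ^+ 2 / 2) <= (1 - normc rho ^+ 2) * t.
  apply: le_trans hdle; rewrite ler_wpM2l // lerD2l lerN2 /t.
  by have := ler_wpM2l rho0 hx; lra.
(* The inequality [1 - y <= (1 - y / 2)^2] prepares the cancellation of a factor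
   [1 - |rho|^2 / 2]. *)
have h5 : (1 - normc rho ^+ 2) * t <= (1 - normc rho ^+ 2 / 2) ^+ 2 * t.
  by rewrite ler_wpM2r ?(ltW t0) //; have := sqr_ge0 (normc rho ^+ 2); lra.
have h6 : d <= (1 - normc rho ^+ 2 / 2) * t.
  rewrite -(@ler_pM2r _ (1 - normc rho ^+ 2 / 2)); last by lra.
  by apply: le_trans h4 _; apply: le_trans h5 _; apply: eq_ler; ring.
apply: le_trans h6 _; rewrite ler_wpM2r ?(ltW t0) // lerD2l lerN2.
by rewrite ler_wpM2r // lerXn2r ?nnegrE ?(ltW x0gt).
Qed.

(** The multipliers in [flow_cross] multiply; the common factor [u - eta'] cancels because [u] lies
    in the open disk and [eta'] on the circle. *)
Lemma flow_comp eta eta' k l z : normc eta = 1 -> normc eta' = 1 ->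
  eta != eta' -> 0 < k <= 1 -> 0 < l <= 1 -> normc z < 1 ->
  flow eta eta' l (flow eta eta' k z) = flow eta eta' (l * k) z.
Proof.
move=> h1 h2 neq hk hl hz.
have hkl : 0 < l * k <= 1.
  have [k0 k1] := andP hk; have [l0 l1] := andP hl.
  by rewrite mulr_gt0 // mulr_ile1 // ltW.
have hu := flow_lt1 h1 h2 neq hk hz.
apply/flow_cross; first exact: flow_den_neq0.
have hc1 := (flow_cross _ (flow_den_neq0 h1 h2 neq hk hz)).2 erefl.
have hc2 := (flow_cross _ (flow_den_neq0 h1 h2 neq hl hu)).2 erefl.
set u := flow eta eta' k z in hu hc1 hc2 *; set v := flow eta eta' l u in hc2 *.
have u0 : u - eta' != 0.
  by rewrite subr_eq0; apply: contraTneq hu => ->; rewrite h2 ltxx.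
apply: (mulIf u0).
transitivity ((v - eta) * (u - eta') * (z - eta')); first by ring.
rewrite hc2; transitivity (l%:C * (v - eta') * ((u - eta) * (z - eta'))).
  by ring.
by rewrite hc1 rmorphM; ring.
Qed.

Lemma flow1 eta eta' z : eta != eta' -> flow eta eta' 1 z = z.
Proof.
move=> neq; rewrite /flow /flow_den rmorph1 !subrr !mul0r subr0 !mul1r add0r.
by rewrite [- eta' + eta]addrC mulrC mulKf // subr_eq0.
Qed.

(** The relation in [flow_cross] is symmetric under exchanging [eta] with [eta'] and [z] with
    [u]. *)
Lemma flowK eta eta' k z : normc eta = 1 -> normc eta' = 1 ->
  eta != eta' -> 0 < k <= 1 -> normc z < 1 ->
  flow eta' eta k (flow eta eta' k z) = z.
Proof.
move=> h1 h2 neq hk hz; have hu := flow_lt1 h1 h2 neq hk hz.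
have hc1 := (flow_cross _ (flow_den_neq0 h1 h2 neq hk hz)).2 erefl.
apply/esym/flow_cross; first by apply: flow_den_neq0 => //; rewrite eq_sym.
by rewrite mulrC hc1; ring.
Qed.

End HyperbolicFlow.

(** * Obstruction to recurrence *)

Section Necessity.
Variable R : realType.
Local Notation C := R[i].
Implicit Types (nu : R) (eta : C).

Lemma sqnorm_le_poly nu (p : {poly C}) : exists B : R,
  sqnorm_le nu (fun n => p`_n) B.
Proof.
have [K _ hK] := sqnorm_le_mul nu p.
exists (K * 1); rewrite -[p]mulr1; apply: hK => -[|N]; first by rewrite big_ord0.
rewrite big_ord_recl coef1 normc1 expr1n mul1r powR1 big1 ?addr0 // => i _.
by rewrite coef1 normc0 expr0n mul0r.
Qed.

(* The functionals [h |-> c n * (h (p n) - h (q n))] are uniformly bounded, and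
   [T^n] turns the [n]-th one into the [0]-th one, or conversely. *)
Lemma not_recurrent nu (T : (C -> C) -> (C -> C)) (p q c : nat -> C) (K kappa : R) :
  0 < K ->
  (forall h a X, has_taylor h a -> 0 < X -> sqnorm_le nu a (X ^+ 2) ->
    forall n, normc (c n * (h (p n) - h (q n))) <= K * X) ->
  (forall n, (0 < n)%N -> normc (c n * (p n - q n)) <= kappa) ->
  kappa < normc (c 0%N * (p 0%N - q 0%N)) ->
  (forall n g, c n * (g (p n) - g (q n)) =
    c 0%N * (iter n T g (p 0%N) - iter n T g (q 0%N))) \/
  (forall n g, c n * (iter n T g (p n) - iter n T g (q n)) =
    c 0%N * (g (p 0%N) - g (q 0%N))) ->
  ~ recurrent nu T.
Proof.
move=> K0 hK hkappa h0 hT hrec.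
pose L n (h : C -> C) := c n * (h (p n) - h (q n)).
have LB n g h : L n (fun z => g z - h z) = L n g - L n h by rewrite /L; ring.
(* Half the gap: a return to [U] would bring [L n id] closer than [2 e] to [L 0 id]. *)
pose e := (normc (L 0%N id) - kappa) / 2.
have e0 : 0 < e by rewrite divr_gt0 // subr_gt0.
(* The slack [d < e], uniform in [n], makes [U] open, since all the functionals share the bound
   [K]. *)
pose U := [set g | dirichlet nu g /\
  exists2 d : R, d < e & forall n, normc (L n g - L n id) <= d].
have Uopen : dirichlet_open nu U.
  split=> [g []//|f [fD [d de hd]]].
  pose X := (e - d) / 2 / K.
  have X0 : 0 < X by rewrite !divr_gt0 // subr_gt0.
  exists X => // g gD gf; split=> //; exists (d + K * X) => [|n].
    by rewrite /X mulrC divfK ?gt_eqF //; lra.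
  have [a [A [ga aA]]] := (dirichletP nu g).1 gD.
  have [b [B [fb bB]]] := (dirichletP nu f).1 fD.
  have gfD : dirichlet nu (fun z => g z - f z).
    apply/dirichletP; exists (fun n => a n - b n), (2 * A + 2 * B).
    by split; [exact: has_taylorB|exact: sqnorm_leB].
  have hX := sqnorm_le_dirichlet_norm (has_taylorB ga fb) gfD.
  have {}hX : sqnorm_le nu (fun n => a n - b n) (X ^+ 2).
    apply: sqnorm_leW hX; rewrite lerXn2r ?nnegrE ?sqrtr_ge0 ?(ltW X0) //.
    exact: ltW.
  have := hK _ _ _ (has_taylorB ga fb) X0 hX n.
  rewrite -/(L n (fun z => g z - f z)) LB => h.
  have -> : L n g - L n id = (L n f - L n id) + (L n g - L n f) by ring.
  by apply: le_trans (ler_normcD _ _) _; rewrite lerD.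
have Uid : U id.
  split; last by exists 0 => // n; rewrite subrr normc0.
  apply/dirichletP; have [B hB] := sqnorm_le_poly nu 'X.
  exists (fun n => ('X : {poly C})`_n), B; split=> //.
  by apply: has_taylor_eq (has_taylor_poly (p := 'X)) => z _; rewrite hornerX.
have [n n0 [_ [[g [gD [d de hd]] <-] [_ [d' d'e hd']]]]] :=
  hrec U Uopen (ex_intro _ id Uid).
have h1 : normc (L n id - L 0%N id) < e + e.
  have [hc|hc] := hT.
    have := hd n; have := hd' 0%N.
    have -> : L 0%N (iter n T g) = L n g by rewrite /L -hc.
    have -> : L n id - L 0%N id = (L n g - L 0%N id) - (L n g - L n id) by ring.
    by move=> ha hb; apply: le_lt_trans (ler_normcB _ _) _; lra.
  have := hd 0%N; have := hd' n.
  have -> : L n (iter n T g) = L 0%N g by exact: hc.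
  have -> : L n id - L 0%N id = (L 0%N g - L 0%N id) - (L 0%N g - L n id) by ring.
  by move=> ha hb; apply: le_lt_trans (ler_normcB _ _) _; lra.
have h2 := hkappa n n0; have h3 := lerB_normcB (L 0%N id) (L n id).
rewrite normcBC in h3; move: h1; rewrite /e.
by move: h2; rewrite -/(L n id); lra.
Qed.

(** The exponents of [k] cancel: [(1 - 2 nu) / 2] from [c], [- (3 - 2 nu) / 2] from the Lipschitz
    constant at radius [1 - c0 k], and 1 from the displacement. *)
Lemma flow_difference_bound nu eta eta' (t : R) : nu < 1 ->
  normc eta = 1 -> normc eta' = 1 -> eta != eta' -> 0 <= t <= 2^-1 ->
  (forall k, 0 < k <= 1 ->
    normc (flow eta eta' k t%:C - flow eta eta' k 0) <= 8 * k * t) ->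
  exists2 K : R, 0 < K & forall k (c : C) h a X, 0 < k <= 1 ->
    normc c <= k `^ ((1 - 2 * nu) / 2) ->
    has_taylor h a -> 0 < X -> sqnorm_le nu a (X ^+ 2) ->
    normc (c * (h (flow eta eta' k t%:C) - h (flow eta eta' k 0))) <= K * X.
Proof.
move=> nu1 h1 h2 neq ht hflow.
have [K K0 hK] := dirichlet_lipschitz nu1.
have dist0 : 0 < normc (eta - eta') ^+ 2 by rewrite exprn_gt0 // normc_gt0 subr_eq0.
have dist4 := sqr_dist_le4 h1 h2.
(* For [|z| <= 1/2], [1 - |z|^2 >= 1/2] turns the 8 of [flow_le] into 16. *)
pose c0 := normc (eta - eta') ^+ 2 / 16.
have c0gt : 0 < c0 by rewrite divr_gt0.
exists (K * 4 * c0 `^ (- ((3 - 2 * nu) / 2))) => [|k c h a X hk hc ha X0 hX].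
  by rewrite !mulr_gt0 ?powR_gt0.
have [k0 k1] := andP hk.
have c0k : 0 < c0 * k by rewrite mulr_gt0.
have hr : 2^-1 <= 1 - c0 * k < 1.
  have c04 : c0 <= 4^-1 by rewrite /c0; lra.
  have : c0 * k <= c0 * 1 by rewrite ler_wpM2l // ltW.
  by rewrite gtrBl c0k andbT; lra.
have hle (z : C) : normc z <= 2^-1 -> normc (flow eta eta' k z) <= 1 - c0 * k.
  move=> hz; apply: le_trans (flow_le h1 h2 neq hk _) _.
    by apply: le_lt_trans hz _; lra.
  have z0 := normc_ge0 z.
  have z4 : 2^-1 <= 1 - normc z ^+ 2 by have := ler_wpM2l z0 hz; lra.
  rewrite lerD2l lerN2 ler_wpM2r ?(ltW k0) // /c0.
  by have := ler_wpM2l (ltW dist0) z4; lra.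
have nt : normc t%:C <= 2^-1 by rewrite normcR ger0_norm; case/andP: ht.
have n0 : normc (0 : C) <= 2^-1 by rewrite normc0 invr_ge0.
have := hK h a X _ _ _ ha X0 hX hr (hle _ nt) (hle _ n0).
rewrite normcM => hh; apply: le_trans (ler_pM (normc_ge0 _) (normc_ge0 _) hc hh) _.
have -> : 1 - (1 - c0 * k) = c0 * k by ring.
rewrite powRM ?(ltW c0gt) ?(ltW k0) //.
set D := normc (_ - _); have hD : D <= 4 * k.
  apply: le_trans (hflow k hk) _.
  have [t0 t2] := andP ht; have := ler_wpM2l (ltW k0) t2; lra.
set w := c0 `^ _; set v := k `^ _; set v' := k `^ _.
have vv : v * v' * k = 1.
  rewrite /v /v' -powRD ?(gt_eqF k0) ?implybT // -{2}[k]powRr1 ?(ltW k0) //.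
  rewrite -powRD ?(gt_eqF k0) ?implybT //.
  have -> : (1 - 2 * nu) / 2 + - ((3 - 2 * nu) / 2) + 1 = 0 by field.
  by rewrite powRr0.
have -> : v * (K * X * D * (w * v')) = (v * v' * (K * X * w)) * D by ring.
have -> : K * 4 * w * X = (v * v' * (K * X * w)) * (4 * k).
  transitivity (K * 4 * w * X * (v * v' * k)); last by ring.
  by rewrite vv mulr1.
by rewrite ler_wpM2l // !mulr_ge0 ?powR_ge0 // ltW.
Qed.

(** A smaller [nu'] lets [nu >= 1/2] be treated with [nu' = 1/2], where the bound on [c] reads
    [|c n| <= 1]. The two alternatives serve [lambda^n] with the flow and [lambda^-n] with the
    inverse flow. *)
Lemma flow_not_recurrent nu nu' (T : (C -> C) -> (C -> C)) eta eta' (mu : R)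
    (c : nat -> C) :
  nu' <= nu -> nu' <= 1 / 2 ->
  normc eta = 1 -> normc eta' = 1 -> eta != eta' -> 0 < mu < 1 ->
  (forall n, normc (c n) <= (mu ^+ n) `^ ((1 - 2 * nu') / 2)) -> c 0%N = 1 ->
  (forall n g z, normc z < 1 ->
    iter n T g z = c n * g (flow eta eta' (mu ^+ n) z)) \/
  (forall n g z, normc z < 1 ->
    c n * iter n T g (flow eta eta' (mu ^+ n) z) = g z) ->
  ~ recurrent nu T.
Proof.
move=> nunu nu2 h1 h2 neq hmu hc c0 hT.
have [t [kappa [t0 t2 kt] ht]] := flow_contraction h1 h2 neq hmu.
have nu1 : nu' < 1 by lra.
have ht2 : 0 <= t <= 2^-1 by rewrite (ltW t0).
have [K K0 hK] := flow_difference_bound nu1 h1 h2 neq ht2 (fun k hk => (ht k hk).1).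
have [mu0 mu1] := andP hmu.
have hmun n : 0 < mu ^+ n <= 1 by rewrite exprn_gt0 // exprn_ile1 // ltW.
have nt : normc t%:C < 1 by rewrite normcR gtr0_norm //; lra.
have n0 : normc (0 : C) < 1 by rewrite normc0.
apply: (@not_recurrent _ _ (fun n => flow eta eta' (mu ^+ n) t%:C)
  (fun n => flow eta eta' (mu ^+ n) 0) c K kappa K0).
- move=> h a X ha X0 hX n.
  by apply: hK ha X0 (sqnorm_le_nuW nunu hX); [exact: hmun|exact: hc].
- move=> [//|n] _; rewrite normcM.
  have hle : mu ^+ n.+1 <= mu by rewrite exprS ler_piMr ?(ltW mu0) //; case/andP: (hmun n).
  have := (ht _ (hmun n.+1)).2 hle; apply: le_trans.
  rewrite ler_piMl ?normc_ge0 //; apply: le_trans (hc _) _.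
  (* The exponent is nonnegative since [nu' <= 1/2], so [|c n| <= 1]. *)
  by rewrite -[leRHS](powRr0 (mu ^+ n.+1)) ger_powR //; lra.
- by rewrite c0 mul1r !expr0 !flow1 // subr0 normcR gtr0_norm.
- have [H|H] := hT; [left|right] => n g /=.
    by rewrite c0 mul1r !expr0 !flow1 // !H // mulrBr.
  by rewrite c0 mul1r !expr0 !flow1 // mulrBr !H.
Qed.

End Necessity.

(** * Recurrence from orbits tending to 0 *)

Section Sufficiency.
Variable R : realType.
Local Notation C := R[i].
Implicit Types (nu : R) (eta : C).

(** The squared norm is at most [K x^n] with [x = |lambda|^2 mu^(1 - 2 nu)], and the bound on
    [|lambda|] says exactly that [x < 1]. Exchanging the fixed points and inverting [lambda] covers
    the backward orbits. *)
Lemma flow_orbit_cvg0 nu eta eta' (mu : R) (lambda : C) (s : {poly C}) j (e : R) :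
  normc eta = 1 -> normc eta' = 1 -> eta != eta' -> 0 < mu < 1 ->
  0 < 2 * j%:R + 2 * nu -> normc lambda < mu `^ ((2 * nu - 1) / 2) -> 0 < e ->
  exists n0, forall n, (n0 <= n)%N -> exists2 a, has_taylor
    (fun z => lambda ^+ n * (s.[flow eta eta' (mu ^+ n) z - eta] *
       (flow eta eta' (mu ^+ n) z - eta) ^+ j.+1)) a & sqnorm_le nu a e.
Proof.
move=> h1 h2 neq hmu hj hlam e0; have [mu0 mu1] := andP hmu.
have dist0 : 0 < normc (eta - eta') ^+ 2 by rewrite exprn_gt0 // normc_gt0 subr_eq0.
have dist4 := sqr_dist_le4 h1 h2.
have hc : 0 < normc (eta - eta') ^+ 2 / 8 <= 2^-1 by lra.
have [K K0 hK] := sqnorm_le_poly_moebius s hc hj.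
pose x := normc lambda ^+ 2 * mu `^ (1 - 2 * nu).
have x0 : 0 <= x by rewrite mulr_ge0 ?sqr_ge0 ?powR_ge0.
have x1 : x < 1.
  have -> : 1 = (mu `^ ((2 * nu - 1) / 2)) ^+ 2 * mu `^ (1 - 2 * nu).
    rewrite -powR_mulrn ?powR_ge0 // -powRrM -powRD ?(gt_eqF mu0) ?implybT //.
    have -> : (2 * nu - 1) / 2 * 2%:R + (1 - 2 * nu) = 0 by field.
    by rewrite powRr0.
  by rewrite ltr_pM2r ?powR_gt0 // ltrXn2r ?nnegrE ?normc_ge0 ?powR_ge0.
have := @cvg_expr R x; rewrite ger0_norm // => /(_ x1) /cvgrPdist_lt.
move=> /(_ (e / (K + 1)))[|N _ hN]; first by rewrite divr_gt0 // ltr_wpDl.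
exists N => n Nn; have hk : 0 < mu ^+ n <= 1.
  by rewrite exprn_gt0 // exprn_ile1 // ltW.
have [a fa ha] := hK (mu ^+ n) eta _ _ hk h1 (flow_ratio_le h1 h2 neq hk)
  (flow_scale_le h1 h2 neq hk).
exists (fun i => lambda ^+ n * a i).
  apply: has_taylor_eq (has_taylorZ (c := lambda ^+ n) fa) => z hz.
  by rewrite -flowE.
apply: sqnorm_leW (sqnorm_leZ _ ha).
have := hN n Nn; rewrite /= sub0r normrN ger0_norm ?exprn_ge0 //.
rewrite ltr_pdivlMr ?ltr_wpDl // => hx.
have -> : normc (lambda ^+ n) ^+ 2 * (K * (mu ^+ n) `^ (1 - 2 * nu)) = x ^+ n * K.
  have -> : (mu ^+ n) `^ (1 - 2 * nu) = (mu `^ (1 - 2 * nu)) ^+ n.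
    by rewrite -(powR_mulrn n (ltW mu0)) powRAC powR_mulrn ?powR_ge0.
  by rewrite normcX /x exprMn exprAC mulrA mulrAC.
apply: le_trans (ltW hx); rewrite ler_wpM2l ?exprn_ge0 // lerDl.
by [].
Qed.

Lemma flow_recurrent nu (T : (C -> C) -> (C -> C)) eta eta' (mu : R) (lambda : C) :
  normc eta = 1 -> normc eta' = 1 -> eta != eta' -> 0 < mu < 1 -> nu < 1 / 2 ->
  mu `^ ((1 - 2 * nu) / 2) < normc lambda < mu `^ ((2 * nu - 1) / 2) ->
  (forall n g z, normc z < 1 ->
    iter n T g z = lambda ^+ n * g (flow eta eta' (mu ^+ n) z)) ->
  recurrent nu T.
Proof.
move=> h1 h2 neq hmu nu2 /andP[hlam1 hlam2] hT U [UD Uopen] [f Uf].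
have [mu0 mu1] := andP hmu; have neq' : eta' != eta by rewrite eq_sym.
have lam0 : lambda != 0 by rewrite -normc_gt0 (lt_trans _ hlam1) ?powR_gt0.
have hlam3 : normc lambda^-1 < mu `^ ((2 * nu - 1) / 2).
  rewrite normcV (_ : (2 * nu - 1) / 2 = - ((1 - 2 * nu) / 2)); last by field.
  by rewrite powRN ltf_pV2 ?posrE ?powR_gt0 // (lt_trans _ hlam1) ?powR_gt0.
have [e e0 he] := Uopen f Uf.
have [a [A [fa aA]]] := (dirichletP nu f).1 (UD f Uf).
(* The squared distance to [f] will be at most [2 (2 e1 + 2 e1) + 2 e1 = e^2 / 2]. *)
pose e1 := e ^+ 2 / 20; have e10 : 0 < e1 by rewrite divr_gt0 ?exprn_gt0.
have [p hp] := sqnorm_le_truncation aA e10.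
have [j hj] : exists j : nat, 0 < 2 * j%:R + 2 * nu.
  exists (Num.bound `|nu|); have := archi_boundP (normr_ge0 nu).
  by have := ler_norm (- nu); rewrite normrN; lra.
have [r hr] := sqnorm_le_density p j.+1 (ltW nu2) h1 e10.
have [r' hr'] := sqnorm_le_density p j.+1 (ltW nu2) h2 e10.
(* Recentring at the fixed points brings the approximants to the form in [flow_orbit_cvg0]. *)
pose s := r \Po ('X + eta%:P); pose s' := r' \Po ('X + eta'%:P).
have sE z : s.[z - eta] * (z - eta) ^+ j.+1 = (r * ('X - eta%:P) ^+ j.+1).[z].
  by rewrite /s horner_comp !hornerE subrK.
have sE' z : s'.[z - eta'] * (z - eta') ^+ j.+1 = (r' * ('X - eta'%:P) ^+ j.+1).[z].
  by rewrite /s' horner_comp !hornerE subrK.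
have [n1 hn1] := flow_orbit_cvg0 s h1 h2 neq hmu hj hlam2 e10.
have [n2 hn2] := flow_orbit_cvg0 s' h2 h1 neq' hmu hj hlam3 e10.
(* The successor ensures [n > 0]. *)
pose n := (maxn n1 n2).+1.
have [b gb hb] := hn1 n (leqW (leq_maxl _ _)).
have [b' gb' hb'] := hn2 n (leqW (leq_maxr _ _)).
set x := r * _ in hr sE; set y := r' * _ in hr' sE'.
(* Both [x] and [y] approximate the same [p], so one estimate places [u] and its image in [U]. *)
have near (w : {poly C}) (v : C -> C) d : sqnorm_le nu (fun n => (p - w)`_n) e1 ->
    has_taylor v d -> sqnorm_le nu d e1 -> forall g,
    (forall z, normc z < 1 -> g z = w.[z] + v z) -> U g.
  move=> hw vd hd g hg.
  have [B hB] := sqnorm_le_poly nu w.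
  have gT : has_taylor g (fun n => w`_n + d n).
    apply: has_taylor_eq (has_taylorD (has_taylor_poly (p := w)) vd) => z hz.
    by rewrite hg.
  apply: he.
    apply/dirichletP; exists (fun n => w`_n + d n), (2 * B + 2 * e1).
    by split; [exact: gT|exact: sqnorm_leD hB hd].
  have hgf : sqnorm_le nu (fun n => w`_n + d n - a n)
      (2 * (2 * e1 + 2 * e1) + 2 * e1).
    have hD := sqnorm_leD (sqnorm_leZ (-1) (sqnorm_leD hp hw)) hd.
    rewrite normcN normc1 expr1n mul1r in hD.
    by apply: eq_sqnorm_le hD => i; rewrite coefB; ring.
  apply: le_lt_trans (dirichlet_norm_le (has_taylorB gT fa) hgf) _.
  rewrite -[ltRHS]ger0_norm ?(ltW e0) // -sqrtr_sqr ltr_sqrt ?exprn_gt0 //.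
  by rewrite /e1; have := exprn_gt0 2 e0; lra.
pose u z := x.[z] + lambda^-1 ^+ n * y.[flow eta' eta (mu ^+ n) z].
have hk : 0 < mu ^+ n <= 1 by rewrite exprn_gt0 // exprn_ile1 // ltW.
have Uu : U u.
  by apply: (near x _ b' hr gb' hb') => z hz; rewrite sE'.
exists n => //; exists (iter n T u); split; first by exists u.
apply: (near y _ b hr' gb hb) => z hz.
rewrite hT // /u flowK // mulrDr addrC; congr (_ + _); last by rewrite sE.
by rewrite mulrA -exprMn divff // expr1n mul1r.
Qed.

End Sufficiency.

(** * Hyperbolic automorphisms of the disk as flows *)

Section Setup.
Variable R : realType.
Local Notation C := R[i].
Implicit Types (phi : lft R) (eta z u c d : C) (m k : R).

Lemma disk_automorphism_maps phi z : disk_automorphism phi -> normc z < 1 ->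
  lft_c phi * z + lft_d phi != 0 /\ normc (lft_fun phi z) < 1.
Proof.
move=> [hfun _ _] hz; have : (Some @` @unit_disk R) (lft_sphere phi (Some z)).
  by apply: hfun; exists z => //; rewrite unit_diskE.
by move=> [w]; rewrite unit_diskE /=; case: ifP => // _ hw [<-].
Qed.

Lemma disk_automorphism_onto phi u : disk_automorphism phi -> normc u < 1 ->
  exists2 z, normc z < 1 & lft_fun phi z = u.
Proof.
move=> [_ _ hsurj] hu; have /hsurj[_ [z hz <-]] : (Some @` @unit_disk R) (Some u).
  by exists u => //; rewrite unit_diskE.
by rewrite unit_diskE in hz => /=; case: ifP => // _ [<-]; exists z.
Qed.

(** The cross-multiplied form survives the poles of [sigma]: the dilation fixes infinity, so if one
    of [z] and its image is a pole, both are, and both sides vanish. *)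
Lemma sphere_conjugation phi sigma m z :
  lft_sphere sigma (lft_sphere phi (Some z)) =
    omap (fun w => m%:C * w) (lft_sphere sigma (Some z)) ->
  lft_c phi * z + lft_d phi != 0 ->
  (lft_a sigma * lft_fun phi z + lft_b sigma) * (lft_c sigma * z + lft_d sigma) =
  m%:C * (lft_a sigma * z + lft_b sigma) *
    (lft_c sigma * lft_fun phi z + lft_d sigma).
Proof.
move=> + den0; have -> : lft_sphere phi (Some z) = Some (lft_fun phi z).
  by rewrite /= (negbTE den0).
set u := lft_fun phi z; rewrite /lft_sphere.
have [u0|u0] := eqVneq (lft_c sigma * u + lft_d sigma) 0;
  have [z0|z0] := eqVneq (lft_c sigma * z + lft_d sigma) 0 => //=.
  by rewrite u0 z0 !mulr0.
move=> [] /(congr1 (fun w => w * (lft_c sigma * u + lft_d sigma) *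
  (lft_c sigma * z + lft_d sigma))).
rewrite /lft_fun divfK // => ->.
by field.
Qed.

(* One of the zero and the pole of the conjugating map is [eta]. *)
Lemma hyperbolic_cross phi eta : hyperbolic phi -> disk_automorphism phi ->
  lft_sphere phi (Some eta) = Some eta ->
  exists m c d, [/\ 0 < m, m != 1, c * eta + d != 0 &
    forall z, normc z < 1 -> (lft_fun phi z - eta) * (c * z + d) =
      m%:C * (z - eta) * (c * lft_fun phi z + d)].
Proof.
move=> [_ _ [[A B c d det] [m [m0 m1 hsig]]]] haut heta.
have [den fix_eta] : lft_c phi * eta + lft_d phi != 0 /\ lft_fun phi eta = eta.
  by move: heta => /=; case: ifP => // _ [].
have := sphere_conjugation (hsig (Some eta)) den; rewrite fix_eta /= => heq.
have {}hsig z : normc z < 1 -> (A * lft_fun phi z + B) * (c * z + d) =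
    m%:C * (A * z + B) * (c * lft_fun phi z + d).
  move=> hz; have [denz _] := disk_automorphism_maps haut hz.
  exact: sphere_conjugation (hsig (Some z)) denz.
(* At [z = eta] the relation says that [eta] is a zero of the numerator or of the denominator of
   [sigma]. *)
have {heq} : (1 - m%:C) * ((A * eta + B) * (c * eta + d)) = 0.
  by rewrite mulrBl mul1r {1}heq; ring.
have mC0 : m%:C != 0 :> C by rewrite -normc_gt0 normcR normr_gt0 gt_eqF.
move=> /eqP; rewrite mulf_eq0 subr_eq0 => /orP[/eqP[h1]|].
  by rewrite h1 eqxx in m1.
rewrite mulf_eq0; move=> /orP[|] /eqP h0.
  have A0 : A != 0.
    apply: contraNneq det => A0; move: h0; rewrite A0 !mul0r add0r => ->.
    by rewrite mul0r subrr.
  have hB : B = - (A * eta) by apply/eqP; rewrite -addr_eq0 addrC h0.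
  exists m, c, d; split=> //; last first.
    move=> z hz; have := hsig z hz; rewrite hB => h; apply: (mulfI A0).
    by transitivity ((A * lft_fun phi z - A * eta) * (c * z + d));
      [ring|rewrite h; ring].
  apply: contraNneq det => h; rewrite hB (_ : d = - (c * eta)).
    by apply/eqP; ring.
  by apply/eqP; rewrite -addr_eq0 addrC h.
have c0 : c != 0.
  apply: contraNneq det => c0; move: h0; rewrite c0 !mul0r add0r => ->.
  by rewrite !mulr0 subrr.
have hd : d = - (c * eta) by apply/eqP; rewrite -addr_eq0 addrC h0.
(* Here [eta] is the pole: exchange numerator and denominator and invert the multiplier. *)
exists m^-1, A, B; split; rewrite ?invr_gt0 ?invr_eq1 //; last first.
  move=> z hz; have := hsig z hz; rewrite hd => h; apply: (mulfI c0).
  rewrite fmorphV; apply: (mulfI mC0).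
  transitivity (m%:C * (A * z + B) * (c * lft_fun phi z - c * eta)); first by ring.
  by rewrite -h; field.
apply: contraNneq det => h; rewrite hd (_ : B = - (A * eta)).
  by apply/eqP; ring.
by apply/eqP; rewrite -addr_eq0 addrC h.
Qed.

(* Evaluate the invariance of the disk at [z = - t * eta] and let [t] tend to 1. *)
Lemma disk_invariance_pole eta c d k : normc eta = 1 -> 0 < k ->
  (forall z, normc z < 1 -> exists2 u, normc u < 1 &
    (u - eta) * (c * z + d) = k%:C * (z - eta) * (c * u + d)) ->
  (1 - k) * (normc c ^+ 2 - normc d ^+ 2) <= 0.
Proof.
move=> heta k0 hinv.
pose X := complex.Re (c * eta) * complex.Re d + complex.Im (c * eta) * complex.Im d.
pose Y := k * normc d ^+ 2 + (2 - k) * normc c ^+ 2 + 2 * X.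
suff h t : 0 < t < 1 ->
    2 * ((1 - k) * (normc c ^+ 2 - normc d ^+ 2)) <= (1 - t) * Y.
  apply/ler_addgt0Pr => e e0; rewrite add0r.
  pose t := Num.max 2^-1 (1 - e / (`|Y| + 1)).
  have Y1 : 0 < `|Y| + 1 by rewrite ltr_wpDl.
  have ht : 0 < t < 1.
    rewrite lt_max invr_gt0 ltr0n /= gt_max gtrBl divr_gt0 // andbT.
    by rewrite invf_lt1 ?ltr1n.
  have := h t ht; have : (1 - t) * Y <= e.
    apply: le_trans (_ : (1 - t) * (`|Y| + 1) <= _).
      rewrite ler_wpM2l //; first by case/andP: ht; lra.
      by apply: le_trans (ler_norm _) _; rewrite lerDl.
    rewrite -ler_pdivlMr // lerBlDr addrC -lerBlDr.
    by rewrite /t le_max lexx orbT.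
  by lra.
move=> /andP[t0 t1].
have hz : normc (- (t%:C * eta)) < 1.
  by rewrite normcN normcM normcR heta mulr1 gtr0_norm.
have [u hu heq] := hinv _ hz.
(* Solving the relation at [z = - t eta] for [u] gives [u D = eta N]; then [|u| < 1] yields
   [|N| <= |D|]. *)
pose D := d + (k - (1 - k) * t)%:C * (c * eta).
pose N := ((1 - k) - k * t)%:C * d - t%:C * (c * eta).
have uD : u * D = eta * N.
  move: heq => /eqP; rewrite -subr_eq0 => /eqP heq.
  apply/eqP; rewrite -subr_eq0 -heq /D /N !rmorphB !rmorphM !rmorphB rmorph1.
  by apply/eqP; ring.
have ND : normc N ^+ 2 <= normc D ^+ 2.
  rewrite lerXn2r ?nnegrE ?normc_ge0 //.
  have -> : normc N = normc u * normc D by rewrite -normcM uD normcM heta mul1r.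
  by rewrite ler_piMl ?normc_ge0 // ltW.
have hcE : normc c ^+ 2 = normc (c * eta) ^+ 2 by rewrite normcM heta mulr1.
have : normc D ^+ 2 - normc N ^+ 2 = k * (1 + t) * ((1 - t) * Y
    - 2 * ((1 - k) * (normc c ^+ 2 - normc d ^+ 2))).
  rewrite /Y /X hcE /D /N !sqr_normcE; move: (c * eta) => E.
  by case: E => x y; case: (d) => x' y' /=; ring.
have kt : 0 < k * (1 + t) by rewrite mulr_gt0 // addr_gt0.
move=> hDN; have : 0 <= k * (1 + t) * ((1 - t) * Y
    - 2 * ((1 - k) * (normc c ^+ 2 - normc d ^+ 2))).
  by rewrite -hDN subr_ge0.
by rewrite pmulr_rge0 // subr_ge0.
Qed.

(** Since [eta] is fixed, the difference quotient simplifies to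
    [(a - eta c) / (c (h + eta) + d)]. *)
Lemma derive1_lft phi eta : lft_c phi * eta + lft_d phi != 0 ->
  lft_fun phi eta = eta ->
  derive1 (lft_fun phi) eta =
    (lft_a phi - eta * lft_c phi) / (lft_c phi * eta + lft_d phi).
Proof.
case: phi => a b c d det /= den fix_eta; rewrite /lft_fun /= in fix_eta *.
have hb : b = eta * (c * eta + d) - a * eta.
  by rewrite -{1}fix_eta divfK //; ring.
rewrite /derive1; apply/cvg_lim => //.
have hden : (fun h : C => c * (h + eta) + d) h @[h --> 0^'] --> c * eta + d.
  have -> : c * eta + d = c * (0 + eta) + d by rewrite add0r.
  apply: cvgD; last exact: cvg_cst.
  apply: cvgM; first exact: cvg_cst.
  by apply: cvgD; [exact: cvg_within|exact: cvg_cst].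
have hlim : (a - eta * c) / (c * (h + eta) + d) @[h --> 0^'] -->
    (a - eta * c) / (c * eta + d).
  by apply: cvgM; [exact: cvg_cst|exact: cvgV].
apply: cvg_trans hlim; apply: near_eq_cvg.
have hne : \forall h \near 0^', c * (h + eta) + d != 0.
  exact: cvgr_neq0 hden den.
near=> h; have h0 : h != 0 by near: h; exact: nbhs_dnbhs_neq.
have hd : c * (h + eta) + d != 0 by near: h.
rewrite fix_eta hb /GRing.scale /=.
by field; rewrite hd h0.
Unshelve. all: by end_near.
Qed.

(** The relation for [phi] and the one for its inverse give opposite inequalities between [|c|] and
    [|d|], so the second fixed point [- d / c] lies on the circle. *)
Lemma hyperbolic_automorphism_flow phi eta :
  hyperbolic phi -> disk_automorphism phi -> attractive_fixpoint phi eta ->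
  exists eta' mu, [/\ normc eta = 1, normc eta' = 1, eta != eta', 0 < mu < 1 &
    derive1 (lft_fun phi) eta = mu%:C /\
    forall z, normc z < 1 -> lft_fun phi z = flow eta eta' mu z].
Proof.
move=> hhyp haut [+ heta hder]; rewrite normr_normc => -[eta1].
have [m [c [d [m0 m1 cd0 hcross]]]] := hyperbolic_cross hhyp haut heta.
have hcd : normc c ^+ 2 = normc d ^+ 2.
  have h1 : (1 - m) * (normc c ^+ 2 - normc d ^+ 2) <= 0.
    apply: (disk_invariance_pole eta1 m0) => z hz; exists (lft_fun phi z).
      by have [] := disk_automorphism_maps haut hz.
    exact: hcross.
  have h2 : (1 - m^-1) * (normc c ^+ 2 - normc d ^+ 2) <= 0.
    apply: (disk_invariance_pole eta1); rewrite ?invr_gt0 // => z hz.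
    have [w hw wz] := disk_automorphism_onto haut hz; exists w => //.
    have := hcross w hw; rewrite wz fmorphV => h.
    have mC0 : m%:C != 0 :> C by rewrite -normc_gt0 normcR normr_gt0 gt_eqF.
    transitivity (m%:C^-1 * (m%:C * (w - eta) * (c * z + d))); first by field.
    by rewrite -h mulrA.
  have h3 : (m - 1) * (normc c ^+ 2 - normc d ^+ 2) <= 0.
    have -> : m - 1 = m * (1 - m^-1) by field; rewrite gt_eqF.
    by rewrite -mulrA pmulr_rle0.
  have : (1 - m) * (normc c ^+ 2 - normc d ^+ 2) = 0 by lra.
  by move=> /eqP; rewrite mulf_eq0 !subr_eq0 eq_sym (negbTE m1) => /eqP.
have c0 : c != 0.
  apply: contraNneq cd0 => c0; move: hcd; rewrite c0 normc0 expr0n /= mul0r add0r.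
  by move=> /esym/eqP; rewrite sqrf_eq0 => /eqP/eq0_normc ->.
pose eta' := - (d / c).
have eta'1 : normc eta' = 1.
  apply/eqP; rewrite -(@eqrXn2 _ 2) ?normc_ge0 //.
  rewrite normcN normcM normcV exprMn exprVn hcd expr1n divff //.
  by rewrite -hcd sqrf_eq0 gt_eqF // normc_gt0.
have neq : eta != eta'.
  apply: contraNneq cd0 => ->; rewrite /eta' mulrN mulrC divfK //.
  by rewrite addrC subrr.
have hd : d = - (c * eta') by rewrite /eta' mulrN opprK mulrC divfK.
have {}hcross z : normc z < 1 ->
    (lft_fun phi z - eta) * (z - eta') = m%:C * (z - eta) * (lft_fun phi z - eta').
  move=> hz; apply: (mulfI c0).
  have := hcross z hz; rewrite hd => h.
  transitivity ((lft_fun phi z - eta) * (c * z - c * eta')); first by ring.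
  by rewrite h; ring.
have [den fix_eta] : lft_c phi * eta + lft_d phi != 0 /\ lft_fun phi eta = eta.
  by move: heta => /=; case: ifP => // _ [].
have hderm : derive1 (lft_fun phi) eta = m%:C.
  rewrite derive1_lft //; apply: (mulIf den); rewrite divfK //.
  case: phi haut hcross fix_eta den {hhyp heta hder} =>
    a b c' d' det haut hcross; rewrite /lft_fun /= => fix_eta den.
  have hb : b = eta * (c' * eta + d') - a * eta.
    by rewrite -{1}fix_eta divfK //; ring.
  (* After division by [z - eta] the relation is affine in [z]; its values at 0 and [1/2] give the
     slope and the constant term, from which the derivative follows. *)
  have hlin z : normc z < 1 -> (a - eta * c') * (z - eta') =
      m%:C * (a * z + b - eta' * (c' * z + d')).
    move=> hz; have [/= hden _] := disk_automorphism_maps haut hz.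
    have ze : z - eta != 0.
      by rewrite subr_eq0; apply: contraTneq hz => ->; rewrite eta1 ltxx.
    apply: (mulIf ze); have := hcross z hz; rewrite /lft_fun /=.
    move=> /(congr1 (fun w => w * (c' * z + d'))) h.
    transitivity ((a * z + b - eta * (c' * z + d')) * (z - eta')).
      by rewrite hb; ring.
    transitivity (((a * z + b) / (c' * z + d') - eta) * (z - eta') * (c' * z + d')).
      by field.
    by rewrite h; field.
  have l0 := hlin 0 _; have l1 := hlin (2^-1 : R)%:C _.
  have {}l0 := l0 ltac:(by rewrite normc0).
  have {}l1 := l1 ltac:(by rewrite normcR ger0_norm // invf_lt1 ?ltr1n).
  have h2 : (2^-1 : R)%:C != 0 :> C by rewrite -normc_gt0 normcR normr_gt0 invr_eq0.
  have slope : a - eta * c' = m%:C * (a - eta' * c').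
    apply: (mulIf h2); set x := (2^-1 : R)%:C in l1 *.
    transitivity ((a - eta * c') * (x - eta') - (a - eta * c') * (0 - eta')).
      by ring.
    by rewrite l0 l1; ring.
  have ne0 : eta - eta' != 0 by rewrite subr_eq0.
  apply: (mulIf ne0).
  transitivity ((a - eta * c') * (0 - eta') + (a - eta * c') * eta); first by ring.
  by rewrite l0 {1}slope hb; ring.
(* Attractiveness excludes [m > 1]. *)
have m2 : 0 < m < 1 by move: hder; rewrite hderm m0 -[X in _ < X]/(1%:C) ltcR.
exists eta', m; split=> //; split=> // z hz.
have m3 : 0 < m <= 1 by lra.
by apply/flow_cross; [exact: flow_den_neq0|exact: hcross].
Qed.

Lemma iter_scaled_composition phi eta eta' (mu : R) (lambda : C) n
    (g : C -> C) z :
  normc eta = 1 -> normc eta' = 1 -> eta != eta' -> 0 < mu < 1 ->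
  (forall z, normc z < 1 -> lft_fun phi z = flow eta eta' mu z) -> normc z < 1 ->
  iter n (scaled_composition lambda phi) g z =
    lambda ^+ n * g (flow eta eta' (mu ^+ n) z).
Proof.
move=> h1 h2 neq hmu hphi; have [mu0 mu1] := andP hmu.
elim: n z => [|n IHn] z hz; first by rewrite !expr0 mul1r flow1.
have hk1 : 0 < mu <= 1 by rewrite mu0 ltW.
have hkn : 0 < mu ^+ n <= 1 by rewrite exprn_gt0 // exprn_ile1 // ltW.
rewrite iterS {1}/scaled_composition hphi // IHn; last exact: flow_lt1.
by rewrite flow_comp // -exprSr mulrA -exprS.
Qed.

End Setup.

Theorem theorem3p6 (R : realType) (phi : lft R) (eta : R[i])
    (hhyp : hyperbolic phi) (haut : disk_automorphism phi)
    (heta : attractive_fixpoint phi eta) (nu : R) (lambda : R[i]) :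
  recurrent nu (scaled_composition lambda phi) <->
  nu < 1 / 2 /\
  complex.Re (derive1 (lft_fun phi) eta) `^ ((1 - 2 * nu) / 2)
    < Normc.normc lambda
    < complex.Re (derive1 (lft_fun phi) eta) `^ ((2 * nu - 1) / 2).
Proof.
have [eta' [mu [h1 h2 neq hmu [-> hphi]]]] :=
  hyperbolic_automorphism_flow hhyp haut heta.
have [mu0 mu1] := andP hmu; have neq' : eta' != eta by rewrite eq_sym.
have hmun n : 0 < mu ^+ n <= 1 by rewrite exprn_gt0 // exprn_ile1 // ltW.
have iterE n g z := @iter_scaled_composition _ phi eta eta' mu lambda n g z
  h1 h2 neq hmu hphi.
split=> [hrec|[nu2 hlam]]; last exact: flow_recurrent iterE.
(* For [nu >= 1/2] this makes [theta = 0]. *)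
pose nu' := Num.min nu (1 / 2).
have nunu : nu' <= nu by rewrite ge_min lexx.
have nu2 : nu' <= 1 / 2 by rewrite ge_min lexx orbT.
set theta := (1 - 2 * nu') / 2.
have powE (x : R) n : 0 <= x -> x <= mu `^ theta -> x ^+ n <= (mu ^+ n) `^ theta.
  move=> x0 hx; rewrite -(powR_mulrn n (ltW mu0)) powRAC powR_mulrn ?powR_ge0 //.
  by rewrite lerXn2r ?nnegrE ?powR_ge0.
have lam_gt : mu `^ theta < normc lambda.
  rewrite ltNge; apply/negP => hle.
  apply: (@flow_not_recurrent _ nu nu' _ eta eta' mu (fun n => lambda ^+ n)
    nunu nu2 h1 h2 neq hmu _ (expr0 _) _ hrec) => [n|].
    by rewrite normcX; apply: powE hle; exact: normc_ge0.
  by left => n g z hz; exact: iterE.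
have lam0 : lambda != 0 by rewrite -normc_gt0 (lt_trans _ lam_gt) ?powR_gt0.
have lam_lt : normc lambda < mu `^ (- theta).
  rewrite ltNge; apply/negP => hle.
  (* The inverse operator: exchange the fixed points and use [lambda^-1]. *)
  apply: (@flow_not_recurrent _ nu nu' _ eta' eta mu (fun n => lambda^-1 ^+ n)
    nunu nu2 h2 h1 neq' hmu _ (expr0 _) _ hrec) => [n|].
    rewrite normcX; apply: powE; first exact: normc_ge0.
    rewrite normcV -[leRHS]invrK lef_pV2 ?posrE ?invr_gt0 ?powR_gt0 ?normc_gt0 //.
    by rewrite -powRN.
  right => n g z hz; rewrite iterE; last exact: flow_lt1.
  by rewrite flowK // mulrA -exprMn mulVf // expr1n mul1r.
have nu_lt : nu < 1 / 2.
  (* Otherwise [theta = 0], and [1 < |lambda| < 1]. *)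
  rewrite ltNge; apply/negP => hnu; have := lt_trans lam_gt lam_lt.
  have -> : theta = 0 by rewrite /theta /nu' min_r //; field.
  by rewrite oppr0 ltxx.
have nuE : nu' = nu by rewrite /nu' min_l // ltW.
split=> //; move: lam_gt lam_lt; rewrite /theta nuE => -> /=.
by rewrite (_ : - ((1 - 2 * nu) / 2) = (2 * nu - 1) / 2) //; field.
Qed.
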